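(* Let $n\ge 1$ and $0\le r\le n-1$ be integers, write $X=[n]=\{1,\dots,n\}$, $f_r=\sum_{j=0}^{r}\binom{n}{j}$ and $g_r=f_r+\binom{n-1}{r}$. Let $A\subseteq Q_n$ satisfy $f_r<|A|\le g_r$ (equivalently, $|X^{(\le r)}|<|A|\le |X^{(\le r)}\cup\{B\in X^{(r+1)}:1\in B\}|$). Put $s=n-r-1$ and $k=|A|-f_r$ (so $1\le k\le\binom{n-1}{s}$), let $\mathcal{A}\subseteq[n]^{(s)}$ be the initial segment of the colexicographic order on $[n]^{(s)}$ of size $k$, and for each $1\le i\le n$ define $\mathcal{A}_{i,0}=\{B\in X_i^{(s-1)}: B\cup\{i\}\in\mathcal{A}\}$, $\mathcal{A}_{i,1}=\{B\in X_i^{(s)}: B\in\mathcal{A}\}$, and $A_i=X^{(\ge s+1)}\cup\mathcal{A}_{i,1}\cup\mathcal{A}_{i,0}$ (so that $|A_i|=|A|$). Then $A$ is extremal if and only if $A$ is isomorphic to $A_i$ for some $i\in\{1,\dots,n\}$.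
   Context: $Q_n$ is the hypercube with vertex set the power set of $[n]$ and metric $d(x,y)=|x\Delta y|$. For $A\subseteq Q_n$ and $t>0$, $N^t(A)=\{x\in Q_n: \min_{y\in A}d(x,y)\le t\}$. We say $N^t(A)$ is minimal if $|N^t(A)|\le|N^t(B)|$ for every $B\subseteq Q_n$ with $|B|=|A|$. A set $A\subseteq Q_n$ is extremal if $N^t(A)$ and $N^t(A^c)$ are minimal for all integers $t>0$, where $A^c=Q_n\setminus A$. Two subsets of $Q_n$ are isomorphic if one is mapped to the other by an automorphism of $Q_n$ (i.e. a map $x\mapsto \sigma(x)\Delta I$ for a permutation $\sigma$ of $[n]$ and a fixed $I\subseteq[n]$). Notation: $X^{(j)}=\{B\subseteq X:|B|=j\}$, $X^{(\le j)}$, $X^{(\ge j)}$ similarly; $X_i=[n]\setminus\{i\}$ and $X_i^{(j)}$ its $j$-subsets. The colexicographic order on $[n]^{(s)}$: $A<_{colex}B$ iff $\max(A\Delta B)\in B$. *)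

(* Defs.v *)
From mathcomp Require Import all_boot all_order all_fingroup.
Set Implicit Arguments. Unset Strict Implicit. Unset Printing Implicit Defensive.

(* Hypercube Q_n: vertices are subsets of 'I_n = {0,...,n-1}
   (0-based encoding of [n] = {1,...,n}, order preserving). *)

Definition symdiff (n : nat) (x y : {set 'I_n}) : {set 'I_n} :=
  (x :\: y) :|: (y :\: x).

Definition hdist (n : nat) (x y : {set 'I_n}) : nat := #|symdiff x y|.

Definition nbhd (n t : nat) (A : {set {set 'I_n}}) : {set {set 'I_n}} :=
  [set x | [exists y in A, hdist x y <= t]].

Definition nbhd_minimal (n t : nat) (A : {set {set 'I_n}}) : Prop :=
  forall B : {set {set 'I_n}}, #|B| = #|A| -> #|nbhd t A| <= #|nbhd t B|.

Definition extremal (n : nat) (A : {set {set 'I_n}}) : Prop :=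
  forall t : nat, 0 < t -> nbhd_minimal t A /\ nbhd_minimal t (~: A).

Definition cube_aut (n : nat) (sigma : {perm 'I_n}) (I : {set 'I_n})
  (x : {set 'I_n}) : {set 'I_n} := symdiff (sigma @: x) I.

Definition cube_iso (n : nat) (A B : {set {set 'I_n}}) : Prop :=
  exists (sigma : {perm 'I_n}) (I : {set 'I_n}), cube_aut sigma I @: A = B.

Definition colex_lt (n : nat) (S T : {set 'I_n}) : bool :=
  [exists m : 'I_n, [&& m \in symdiff S T,
     [forall j : 'I_n, (j \in symdiff S T) ==> (j <= m)] & m \in T]].

(* initial segment of size k of the colex order on [n]^(s):
   the s-sets having fewer than k colex-predecessors among s-sets *)
Definition colex_init (n s k : nat) : {set {set 'I_n}} :=
  [set S : {set 'I_n} | (#|S| == s) &&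
     (#|[set T : {set 'I_n} | (#|T| == s) && colex_lt T S]| < k)].

Definition f_r (n r : nat) : nat := \sum_(j < r.+1) 'C(n, j).
Definition g_r (n r : nat) : nat := f_r n r + 'C(n.-1, r).

Definition A_i (n r k : nat) (i : 'I_n) : {set {set 'I_n}} :=
  let s := n - r - 1 in
  let calA := colex_init n s k in
  let Ai1 := [set B : {set 'I_n} | (i \notin B) && (B \in calA)] in
  let Ai0 := [set B : {set 'I_n} |
                [&& i \notin B, #|B|.+1 == s & (i |: B) \in calA]] in
  [set x : {set 'I_n} | s.+1 <= #|x|] :|: Ai1 :|: Ai0.

(* Main.v *)
Require Import Defs.
From mathcomp Require Import all_boot all_order all_fingroup.
From mathcomp Require Import zify.
Set Implicit Arguments. Unset Strict Implicit. Unset Printing Implicit Defensive.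

(** Put s = n - r - 1 and let C consist of all sets of size > s together with
    the first k sets of [n]^(s) in colex; C is an initial segment of the order
    "larger sets first, then colex". Harper's theorem, proved by compressing
    along each coordinate inside subcubes, says that initial segments have
    minimal neighbourhoods, and complementation reverses the order.

    Each [A_i] is the image of C under the involution that flips i exactly on
    the points x with |x \ {i}| < s. For any set lying between {|x| > s} and
    {|x| >= s} this involution commutes with taking neighbourhoods (with s
    decreasing by one at each step), so [A_i] is extremal because C is.

    Conversely, compare an extremal A with C. As A^c is as far from some point as
    C^c is from [n], we may assume that A contains {|x| > s}; as N^(s-1)(C)
    misses both the empty set and {n}, N^(s-1)(A) misses some singleton {i}.
    Undoing the involution at i turns A into {|x| > s} plus a family of s-sets
    whose iterated shadows are as small, and whose iterated upward closures are
    as large, as those of the colex segment. The largest clique and the support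
    of such a family determine all of it but a link, and induction on s
    shows that it is a colex segment up to a permutation. *)

(** * Initial segments of a weighted finite type *)

Section InitialSegments.

Variables (T : finType) (f : T -> nat).
Hypothesis f_inj : injective f.
Implicit Types P I J A : {set T}.

(** A linear order is encoded by an injective weight. The same facts then serve colex on a layer and
    the order [sw] on a subcube, and total weight becomes available as a potential for
    compression. *)
Definition initial_in P I : Prop :=
  I \subset P /\ forall x y, x \in I -> y \in P -> f y < f x -> y \in I.

(** Counting predecessors matches the form of [colex_init]. *)
Definition segment P m : {set T} :=
  [set x in P | #|[set y in P | f y < f x]| < m].

Lemma initial_in_nested P I J :
  initial_in P I -> initial_in P J -> #|I| <= #|J| -> I \subset J.
Proof.
move=> [IP Ii] [JP Ji] leIJ; apply/subsetP => x xI; apply/negPn/negP => xJ.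
have JI : J \subset I.
  apply/subsetP => y yJ; case: (ltngtP (f y) (f x)) => [lt|lt|/f_inj ->//].
    by apply: Ii xI _ lt; apply: (subsetP JP).
  by case/negP: xJ; apply: Ji yJ _ lt; apply: (subsetP IP).
have : J \proper I by apply/properP; split=> //; exists x.
by move/proper_card; rewrite ltnNge leIJ.
Qed.

Lemma initial_in_unique P I J :
  initial_in P I -> initial_in P J -> #|I| = #|J| -> I = J.
Proof.
move=> hI hJ e; apply/eqP; rewrite eqEsubset.
by rewrite !(@initial_in_nested P) // e.
Qed.

Lemma initial_in_segment P I : initial_in P I -> I = segment P #|I|.
Proof.
move=> [IP Ii]; apply/setP => x; rewrite inE.
case xP: (x \in P) => /=; last by apply/negbTE/negP => /(subsetP IP); rewrite xP.
apply/idP/idP => [xI|].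
  apply: (@leq_trans #|I :\ x|.+1); last by rewrite [#|I|](cardsD1 x) xI.
  rewrite ltnS; apply/subset_leq_card/subsetP => y; rewrite !inE => /andP[yP lt].
  rewrite (Ii x) // andbT; apply/eqP => e; by rewrite e ltnn in lt.
apply: contraLR => xI; rewrite -leqNgt; apply/subset_leq_card/subsetP => y yI.
rewrite inE (subsetP IP) //=; case: (ltngtP (f y) (f x)) => // [lt|/f_inj e].
  by case/negP: xI; apply: Ii yI xP lt.
by rewrite -e yI in xI.
Qed.

Lemma ex_initial_in P m : m <= #|P| -> exists2 I, initial_in P I & #|I| = m.
Proof.
elim: m => [_|m IH lt].
  by exists set0; rewrite ?cards0 //; split=> [|x y]; rewrite ?sub0set ?inE.
have [I [IP Ii] cI] := IH (ltnW lt).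
have /set0Pn [x0 x0D] : P :\: I != set0.
  by rewrite -card_gt0 cardsD (setIidPr IP) cI subn_gt0.
have [x xD xmin] := arg_minnP (P := fun z => z \in P :\: I) f x0D.
move: xD; rewrite inE => /andP[xI xP].
exists (x |: I); last by rewrite cardsU1 xI cI.
split; first by rewrite subUset sub1set xP.
move=> u y; rewrite !inE => uI yP lt'; have [//|yx /=] := eqVneq y x.
apply/negPn/negP => yI; have := xmin y; rewrite inE yI yP => /(_ isT) le.
case/orP: uI => [/eqP e|uI]; first by move: lt'; rewrite e ltnNge le.
by case/negP: yI; apply: Ii uI yP lt'.
Qed.

Lemma segmentP P m : m <= #|P| -> initial_in P (segment P m) /\ #|segment P m| = m.
Proof.
by case/ex_initial_in => I hI <-; rewrite -initial_in_segment.
Qed.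

Lemma ltn_sum_set (U V : {set T}) : #|U| = #|V| -> U != set0 ->
  (forall u v, u \in U -> v \in V -> f u < f v) ->
  \sum_(u in U) f u < \sum_(v in V) f v.
Proof.
move=> e /set0Pn[u0 u0U] lt.
have [u uU umax] := arg_maxnP (P := fun z => z \in U) f u0U.
apply: (@leq_ltn_trans (#|U| * f u)).
  by rewrite -sum_nat_const; apply: leq_sum => v /umax.
apply: (@leq_trans (#|V| * (f u).+1)).
  by rewrite -e ltn_pmul2l // card_gt0; apply/set0Pn; exists u0.
by rewrite -sum_nat_const; apply: leq_sum => v vV; apply: lt.
Qed.

(** Outside the common part, each point of [I] weighs less than each point of [A]. The equality case
    is what makes a compression that changes something strictly lower the total weight. *)
Lemma initial_in_sum P I A : initial_in P I -> A \subset P -> #|I| = #|A| ->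
  \sum_(x in I) f x <= \sum_(x in A) f x ?= iff (I == A).
Proof.
move=> [IP Ii] AP e.
have [->|nIA] := eqVneq I A; first by split; rewrite ?eqxx.
suff lt : \sum_(x in I) f x < \sum_(x in A) f x.
  by split; [exact: ltnW | apply/negbTE; rewrite neq_ltn lt].
rewrite (big_setID A) /= [X in _ < X](big_setID I) /= (setIC A) ltn_add2l.
apply: ltn_sum_set.
- by rewrite !cardsD setIC e.
- apply: contraNneq nIA => /eqP; rewrite setD_eq0 => sub.
  by rewrite eqEcard sub e leqnn.
move=> u v; rewrite !inE => /andP[uA uI] /andP[vI vA].
case: (ltngtP (f u) (f v)) => // [lt|/f_inj eq].
  by case/negP: vI; apply: Ii uI _ lt; apply: (subsetP AP).
by rewrite eq vA in uA.
Qed.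

End InitialSegments.

(** * Hamming distance and the simplicial weight *)

Section Cube.
Variable n : nat.
Implicit Types (x y z S : {set 'I_n}) (A B C : {set {set 'I_n}}) (i j : 'I_n) (I : {set 'I_n}) (sigma : {perm 'I_n}).

Lemma in_symdiff i x y : (i \in symdiff x y) = (i \in x) (+) (i \in y).
Proof. by rewrite !inE; case: (i \in x); case: (i \in y). Qed.

(* Locked: otherwise [inE] and [in_symdiff] would see through [flip]. *)
Fact flip_key : unit. Proof. by []. Qed.
Definition flip i x := locked_with flip_key (symdiff x [set i]).

Lemma in_flip i j x : (j \in flip i x) = (j \in x) (+) (j == i).
Proof. by rewrite /flip; case: flip_key; rewrite in_symdiff inE. Qed.

Lemma flipK i : involutive (flip i).
Proof. by move=> x; apply/setP => j; rewrite !in_flip -addbA addbb addbF. Qed.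

Lemma hdistC x y : hdist x y = hdist y x.
Proof. by rewrite /hdist /symdiff setUC. Qed.

Lemma hdistxx x : hdist x x = 0.
Proof. by rewrite /hdist /symdiff setDv setU0 cards0. Qed.

Lemma hdist_eq0 x y : (hdist x y == 0) = (x == y).
Proof.
apply/idP/eqP => [|->]; last by rewrite hdistxx.
rewrite cards_eq0 => /eqP e; apply/setP => i.
by have := in_symdiff i x y; rewrite e inE; case: (i \in x); case: (i \in y).
Qed.

Lemma hdist_triangle x y z : hdist x z <= hdist x y + hdist y z.
Proof.
apply: leq_trans (leq_card_setU _ _); apply/subset_leq_card/subsetP => i.
rewrite in_setU !in_symdiff; by case: (i \in x); case: (i \in y); case: (i \in z).
Qed.

Lemma hdist_subset x y : x \subset y -> hdist x y = #|y| - #|x|.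
Proof.
move=> sub; rewrite /hdist /symdiff.
have -> : x :\: y = set0 by apply/eqP; rewrite setD_eq0.
by rewrite set0U cardsD (setIidPr sub).
Qed.

Lemma card_leq_hdist x y : #|x| <= #|y| + hdist x y.
Proof.
apply: leq_trans (leq_card_setU _ _); apply/subset_leq_card/subsetP => i.
rewrite in_setU in_symdiff; by case: (i \in x); case: (i \in y).
Qed.

Lemma hdist_flip i x : hdist x (flip i x) = 1.
Proof.
suff e : symdiff x (flip i x) = [set i] by rewrite /hdist e cards1.
by apply/setP => j; rewrite in_symdiff in_flip inE addbA addbb.
Qed.

Lemma hdist_flip2 i x y : hdist (flip i x) (flip i y) = hdist x y.
Proof.
suff e : symdiff (flip i x) (flip i y) = symdiff x y by rewrite /hdist e.
apply/setP => j; rewrite !(in_flip, in_symdiff).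
by case: (j \in x); case: (j \in y); case: (j == i).
Qed.

Lemma hdist_flip_in i x y : i \in symdiff x y -> (hdist (flip i x) y).+1 = hdist x y.
Proof.
move=> h; suff e : symdiff (flip i x) y = symdiff x y :\ i.
  by rewrite /hdist e [RHS](cardsD1 i) h.
apply/setP => j; rewrite in_setD1 !(in_flip, in_symdiff); have [->|] := eqVneq j i.
  by move: h; rewrite in_symdiff; case: (i \in x); case: (i \in y).
by rewrite addbF.
Qed.

Lemma hdist_le1P x y : reflect (x = y \/ exists i, x = flip i y) (hdist x y <= 1).
Proof.
apply: (iffP idP) => [|[->|[i ->]]]; last 2 first.
- by rewrite hdistxx.
- by rewrite hdistC hdist_flip.
have [->|nxy] := eqVneq x y; first by left.
have : hdist x y != 0 by rewrite hdist_eq0.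
rewrite -lt0n card_gt0 => /set0Pn[i ii] le; right; exists i.
have : hdist (flip i x) y = 0 by have := hdist_flip_in ii; lia.
by move/eqP; rewrite hdist_eq0 => /eqP <-; rewrite flipK.
Qed.

Lemma hdist_leS t x y :
  (hdist x y <= t.+1) = [exists z, (hdist x z <= 1) && (hdist z y <= t)].
Proof.
apply/idP/existsP => [le|[z /andP[h1 h2]]]; last first.
  by apply: leq_trans (hdist_triangle x z y) _; lia.
have [<-|nxy] := eqVneq x y; first by exists x; rewrite hdistxx.
have : hdist x y != 0 by rewrite hdist_eq0.
rewrite -lt0n card_gt0 => /set0Pn[i ii]; exists (flip i x).
by rewrite hdist_flip leqnn; have := hdist_flip_in ii; lia.
Qed.

(** * Neighbourhoods and automorphisms *)

Lemma nbhdP t A x : reflect (exists2 y, y \in A & hdist x y <= t) (x \in nbhd t A).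
Proof. by rewrite inE; apply: (iffP exists_inP). Qed.

Lemma nbhd1P A x :
  reflect (x \in A \/ exists i, flip i x \in A) (x \in nbhd 1 A).
Proof.
apply: (iffP (nbhdP _ _ _)) => [[y yA /hdist_le1P[->|[i e]]]|[xA|[i h]]].
- by left.
- by right; exists i; rewrite e flipK.
- by exists x; rewrite ?hdistxx.
- by exists (flip i x); rewrite ?hdist_flip.
Qed.

Lemma nbhd0 A : nbhd 0 A = A.
Proof.
apply/setP => x; apply/nbhdP/idP => [[y yA]|xA]; last by exists x; rewrite ?hdistxx.
by rewrite leqn0 hdist_eq0 => /eqP ->.
Qed.

Lemma nbhdS t A : nbhd t.+1 A = nbhd 1 (nbhd t A).
Proof.
apply/setP => x; apply/nbhdP/nbhdP => [[y yA]|[z /nbhdP[y yA h] h1]].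
  rewrite hdist_leS => /existsP[z /andP[h1 h2]]; exists z => //.
  by apply/nbhdP; exists y.
by exists y => //; rewrite hdist_leS; apply/existsP; exists z; rewrite h1.
Qed.

Lemma nbhd_sub t A B : A \subset B -> nbhd t A \subset nbhd t B.
Proof.
move=> sub; apply/subsetP => x /nbhdP[y yA h]; apply/nbhdP; exists y => //.
exact: (subsetP sub).
Qed.

Lemma in_cube_aut sigma I x j :
  (sigma j \in cube_aut sigma I x) = (j \in x) (+) (sigma j \in I).
Proof. by rewrite in_symdiff mem_imset //; apply: perm_inj. Qed.

Lemma hdist_cube_aut sigma I x y :
  hdist (cube_aut sigma I x) (cube_aut sigma I y) = hdist x y.
Proof.
suff e : symdiff (cube_aut sigma I x) (cube_aut sigma I y) = sigma @: symdiff x y.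
  by rewrite /hdist e card_imset //; apply: perm_inj.
apply/setP => j; rewrite -[j](permKV sigma) mem_imset; last exact: perm_inj.
rewrite !(in_cube_aut, in_symdiff).
by case: (_ \in x); case: (_ \in y); case: (_ \in I).
Qed.

Lemma cube_aut_inj sigma I : injective (@cube_aut n sigma I).
Proof.
by move=> x y e; apply/eqP; rewrite -hdist_eq0 -(hdist_cube_aut sigma I) e hdistxx.
Qed.

Lemma nbhd_cube_aut t sigma I A :
  nbhd t (cube_aut sigma I @: A) = cube_aut sigma I @: nbhd t A.
Proof.
apply/setP => x; have /codomP[u ->] := injF_onto (@cube_aut_inj sigma I) x.
rewrite mem_imset; last exact: cube_aut_inj.
apply/nbhdP/nbhdP => [[_ /imsetP[y yA ->]]|[y yA h]].
  by rewrite hdist_cube_aut; exists y.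
by exists (cube_aut sigma I y); rewrite ?imset_f // hdist_cube_aut.
Qed.

Lemma card_nbhd_cube_aut t sigma I A :
  #|nbhd t (cube_aut sigma I @: A)| = #|nbhd t A|.
Proof. by rewrite nbhd_cube_aut card_imset //; apply: cube_aut_inj. Qed.

Lemma cube_aut_setC sigma I A :
  cube_aut sigma I @: (~: A) = ~: (cube_aut sigma I @: A).
Proof.
have inj := @cube_aut_inj sigma I.
apply/setP => x; have /codomP[u ->] := injF_onto inj x.
by rewrite inE !mem_imset // inE.
Qed.

(** * Binary weights and the colex order *)

(** The set read as a binary number: colex becomes comparison of naturals, since the largest point
    of difference is the leading differing digit. *)
Definition wt x : nat := \sum_(j in x) 2 ^ j.

Lemma wtU1 i x : i \notin x -> wt (i |: x) = 2 ^ i + wt x.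
Proof. by move=> ix; rewrite /wt big_setU1. Qed.

Lemma wtD1 i x : i \in x -> wt x = 2 ^ i + wt (x :\ i).
Proof. by move=> ix; rewrite -wtU1 ?setD11 // setD1K. Qed.

Lemma wt_lt m x : (forall j, j \in x -> j < m) -> wt x < 2 ^ m.
Proof.
elim: m x => [|m IH] x h.
  by rewrite /wt big_pred0 // => j; apply/negbTE/negP => /h.
have [/existsP[i /andP[ix /eqP im]]|/existsPn no] := boolP [exists i, (i \in x) && (i == m :> nat)].
  rewrite (wtD1 ix) im expnS mul2n -addnn ltn_add2l; apply: IH => j.
  rewrite !inE => /andP[ji jx]; have := h _ jx.
  by rewrite ltnS leq_eqVlt => /orP[/eqP e|//]; case/eqP: ji; apply: val_inj; rewrite /= e im.
apply: ltn_trans (IH x _) _; last by rewrite ltn_exp2l.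
move=> j jx; have := no j; rewrite jx /=; have := h _ jx; lia.
Qed.

Lemma wt_lt_max m x y : m \in symdiff x y ->
  (forall j, j \in symdiff x y -> j <= m) -> m \in y -> wt x < wt y.
Proof.
move=> mxy mmax my; have mx : m \notin x by move: mxy; rewrite in_symdiff my; case: (m \in x).
rewrite /wt (big_setID y) /= [X in _ < X](big_setID x) /= (setIC y) ltn_add2l.
apply: (@leq_trans (2 ^ m)).
  apply: wt_lt => j; rewrite inE => /andP[jy jx]; have jxy : j \in symdiff x y.
    by rewrite in_symdiff jx (negbTE jy).
  rewrite ltn_neqAle mmax // andbT; apply: contraNneq jy => e.
  by rewrite (_ : j = m) //; apply: val_inj.
by rewrite (big_setD1 m) /= ?inE ?mx ?leq_addr.
Qed.

Lemma colex_total x y : x != y -> colex_lt x y || colex_lt y x.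
Proof.
rewrite -hdist_eq0 -lt0n card_gt0 => /set0Pn[i0 h0].
have [m mxy mmax] := arg_maxnP (P := fun u : 'I_n => u \in symdiff x y) (@nat_of_ord n) h0.
have := mxy; rewrite in_symdiff => mm.
have yx : symdiff y x = symdiff x y by rewrite /symdiff setUC.
have [my|my] := boolP (m \in y).
  apply/orP; left; apply/existsP; exists m; rewrite mxy my andbT.
  by apply/forall_inP => j /mmax.
apply/orP; right; apply/existsP; exists m; rewrite yx mxy /=.
move: mm; rewrite (negbTE my) addbF => ->; rewrite andbT.
by apply/forall_inP => j /mmax.
Qed.

Lemma colex_wt_lt x y : colex_lt x y -> wt x < wt y.
Proof.
case/existsP => m /and3P[mxy /forall_inP mmax my]; exact: wt_lt_max mxy mmax my.
Qed.

Lemma colex_ltE x y : colex_lt x y = (wt x < wt y).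
Proof.
apply/idP/idP => [/colex_wt_lt//|lt]; have [e|/colex_total] := eqVneq x y.
  by rewrite e ltnn in lt.
by case/orP => [//|/colex_wt_lt]; lia.
Qed.

Lemma wt_inj : injective wt.
Proof.
move=> x y e; apply/eqP/negPn/negP => /colex_total.
by rewrite !colex_ltE e ltnn.
Qed.

(* Orders the cube by decreasing size, ties being broken by colex. *)
Definition sw x : nat := (n - #|x|) * 2 ^ n + wt x.

Lemma wt_ub x : wt x < 2 ^ n.
Proof. exact: wt_lt. Qed.

Lemma card_ub x : #|x| <= n.
Proof. by rewrite -[X in _ <= X]card_ord max_card. Qed.

Lemma sw_ltE x y :
  (sw x < sw y) = (#|y| < #|x|) || ((#|x| == #|y|) && (wt x < wt y)).
Proof.
rewrite /sw; have := wt_ub x; have := wt_ub y; have := card_ub x; have := card_ub y.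
move: (wt x) (wt y) (2 ^ n) => a b N; case: (ltngtP #|x| #|y|) => /= [h|h|->] *.
- by apply/negbTE; rewrite -leqNgt; nia.
- by nia.
- by rewrite ltn_add2l.
Qed.

Lemma sw_inj : injective sw.
Proof.
move=> x y e; have := sw_ltE x y; have := sw_ltE y x; rewrite e ltnn.
case: (ltngtP #|x| #|y|) => //= _ h1 h2; apply: wt_inj; lia.
Qed.

(** Inserting [i] changes [sw] by the negative amount 2^i - 2^n, whatever [x] is; the additive form
    avoids truncated subtraction. *)
Lemma swU1 i x : i \notin x -> sw (i |: x) + 2 ^ n = sw x + 2 ^ i.
Proof.
move=> ix; rewrite /sw wtU1 // cardsU1 ix; have := card_ub (i |: x).
rewrite cardsU1 ix; nia.
Qed.

Lemma sw_flip_down i x : i \notin x -> sw (flip i x) < sw x.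
Proof.
move=> ix; have -> : flip i x = i |: x.
  by apply/setP => j; rewrite in_flip !inE; have [->|] := eqVneq j i; rewrite ?(negbTE ix) ?addbF.
have := swU1 ix; have : 2 ^ i < 2 ^ n by rewrite ltn_exp2l. lia.
Qed.

End Cube.

(** * Harper's theorem in subcubes *)

Section Harper.
Variable n : nat.
Implicit Types (x y z u v S : {set 'I_n}) (A B C U V I : {set {set 'I_n}}) (i j : 'I_n).

Lemma flipC i j x : flip i (flip j x) = flip j (flip i x).
Proof. by apply/setP => k; rewrite !in_flip -!addbA [(k == j) (+) _]addbC. Qed.

Lemma flip_inj i : injective (@flip n i).
Proof. exact: inv_inj (flipK i). Qed.

Lemma flipU1 i x : i \notin x -> flip i x = i |: x.
Proof.
move=> ix; apply/setP => j; rewrite in_flip !inE.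
by have [->|] := eqVneq j i; rewrite ?(negbTE ix) ?addbF.
Qed.

Lemma flipD1 i x : i \in x -> flip i x = x :\ i.
Proof.
move=> ix; apply/setP => j; rewrite in_flip !inE.
by have [->|] := eqVneq j i; rewrite ?ix ?addbF.
Qed.

Lemma flip_subset i x S : i \in S -> (flip i x \subset S) = (x \subset S).
Proof.
move=> iS; apply/subsetP/subsetP => h j; have := h j; rewrite in_flip;
  by have [->|] := eqVneq j i; rewrite ?addbF.
Qed.

Lemma sw_flip i x : i \notin x -> sw (flip i x) + 2 ^ n = sw x + 2 ^ i.
Proof. by move=> ix; rewrite flipU1 // swU1. Qed.

Lemma sw_flip_lt2 i j x : i \notin x -> j \notin x -> i < j ->
  sw (flip i x) < sw (flip j x).
Proof.
move=> /sw_flip hi /sw_flip hj lt; have {lt} : 2 ^ i < 2 ^ j by rewrite ltn_exp2l.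
lia.
Qed.

Lemma sw_flip_lt i x y : (i \in x) = (i \in y) ->
  (sw (flip i x) < sw (flip i y)) = (sw x < sw y).
Proof.
move=> e; have [ix|ix] := boolP (i \in x).
  have := @sw_flip i (flip i x); have := @sw_flip i (flip i y).
  rewrite !in_flip -e ix eqxx !flipK => /(_ isT) h1 /(_ isT); lia.
have := sw_flip ix; rewrite e in ix; have := sw_flip ix; lia.
Qed.

(** The upper section [sec1] is stored with [i] removed, so both sections live in the same subcube
    of sets avoiding [i]. *)
Definition sec0 i A := [set x : {set 'I_n} in A | i \notin x].
Definition sec1 i A := [set x : {set 'I_n} | (i \notin x) && (flip i x \in A)].

Lemma sum_sections i A (F : {set 'I_n} -> nat) :
  \sum_(x in A) F x = \sum_(x in sec0 i A) F x + \sum_(x in sec1 i A) F (flip i x).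
Proof.
rewrite (big_setID [set x : {set 'I_n} | i \notin x]) /=; congr (_ + _).
  by apply: eq_bigl => x; rewrite !inE.
rewrite (reindex_inj (@flip_inj i)); apply: eq_bigl => x.
by rewrite !inE in_flip eqxx addbT negbK.
Qed.

Lemma card_sections i A : #|A| = #|sec0 i A| + #|sec1 i A|.
Proof. by rewrite -!sum1_card (sum_sections i). Qed.

Definition glue i U V := [set x : {set 'I_n} | if i \in x then flip i x \in V else x \in U].

Lemma sec0_glue i U V : (forall x, x \in U -> i \notin x) -> sec0 i (glue i U V) = U.
Proof.
move=> h; apply/setP => x; rewrite !inE.
have [ix|//] := boolP (i \in x); last by rewrite andbT.
by rewrite andbF; apply/esym/negP => /h; rewrite ix.
Qed.

Lemma sec1_glue i U V : (forall x, x \in V -> i \notin x) -> sec1 i (glue i U V) = V.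
Proof.
move=> h; apply/setP => x; rewrite !inE in_flip eqxx addbT flipK.
have [ix|//] := boolP (i \in x).
by apply/esym/negP => /h; rewrite ix.
Qed.

(** Subcubes are the power sets of subsets [S] of the fixed ground set, so induction on dimension
    needs no change of type. *)
Definition nbhd_in S A := powerset S :&: nbhd 1 A.

Lemma in_sec0 i A x : (x \in sec0 i A) = (x \in A) && (i \notin x).
Proof. by rewrite inE. Qed.

Lemma in_sec1 i A x : (x \in sec1 i A) = (i \notin x) && (flip i x \in A).
Proof. by rewrite inE. Qed.

Lemma in_nbhd_in S A x : (x \in nbhd_in S A) = (x \subset S) && (x \in nbhd 1 A).
Proof. by rewrite in_setI powersetE. Qed.

(** A point of the lower half is reached either inside that half or by crossing in direction [i]. *)
Lemma nbhd_in_sec0 S i A : i \in S -> A \subset powerset S ->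
  sec0 i (nbhd_in S A) = nbhd_in (S :\ i) (sec0 i A) :|: sec1 i A.
Proof.
move=> iS AS; apply/setP => x; rewrite in_setU in_sec0 in_sec1 !in_nbhd_in.
have [ix|ix] := boolP (i \in x).
  by rewrite andbF subsetD1 ix andbF.
rewrite andbT subsetD1 ix andbT /=; apply/andP/orP => [[xS]|[/andP[xS]|xA]].
- case/nbhd1P => [xA|[j jA]].
    by left; rewrite xS; apply/nbhd1P; left; rewrite inE xA.
  have [e|ji] := eqVneq j i; first by right; rewrite -e.
  left; rewrite xS; apply/nbhd1P; right; exists j.
  by rewrite inE jA in_flip (negbTE ix) eq_sym (negbTE ji).
- move=> h; split=> //; apply/nbhd1P; case/nbhd1P: h => [|[j]]; rewrite inE => /andP[h _].
    by left.
  by right; exists j.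
- split; last by apply/nbhd1P; right; exists i.
  by have := subsetP AS _ xA; rewrite powersetE flip_subset.
Qed.

Lemma nbhd_in_sec1 S i A : i \in S -> A \subset powerset S ->
  sec1 i (nbhd_in S A) = nbhd_in (S :\ i) (sec1 i A) :|: sec0 i A.
Proof.
move=> iS AS; apply/setP => x; rewrite in_setU in_sec0 in_sec1 !in_nbhd_in.
have [ix|ix] := boolP (i \in x).
  by rewrite andbF subsetD1 ix andbF.
rewrite andbT subsetD1 ix andbT /= flip_subset //; apply/andP/orP => [[xS]|[/andP[xS]|xA]].
- case/nbhd1P => [xA|[j jA]].
    by left; rewrite xS; apply/nbhd1P; left; rewrite inE xA ix.
  have [e|ji] := eqVneq j i; first by right; rewrite e flipK in jA.
  left; rewrite xS; apply/nbhd1P; right; exists j.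
  by rewrite inE in_flip (negbTE ix) eq_sym (negbTE ji) flipC.
- move=> h; split=> //; apply/nbhd1P; case/nbhd1P: h => [|[j]]; rewrite inE => /andP[_ h].
    by left.
  by right; exists j; rewrite flipC.
- split; last by apply/nbhd1P; right; exists i; rewrite flipK.
  by have := subsetP AS _ xA; rewrite powersetE.
Qed.

(** For every direction in [S], both sections are initial segments. *)
Definition compressed S B := forall i x y, i \in S -> x \subset S -> y \in B ->
  (i \in x) = (i \in y) -> sw x < sw y -> x \in B.

(** The point [x] contributes nothing new: a neighbour above [x] in size is itself in [D], while [x]
    and each [x] minus [j] enter [D] once the least coordinate [a] is inserted. *)
Lemma nbhd_in_swap S x y (D : {set {set 'I_n}}) (a : 'I_n) : x \subset S -> a \in S ->
  (forall j, j \in S -> a <= j) -> a \notin x ->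
  (forall z, z \subset S -> sw z < sw x -> z \in D) ->
  nbhd_in S (x |: D) \subset nbhd_in S (y |: D).
Proof.
move=> xS aS amin ax hD; apply/subsetP => u; rewrite !in_nbhd_in => /andP[uS hu].
rewrite uS andTb; have sub : u \in nbhd 1 D -> u \in nbhd 1 (y |: D).
  by apply: (subsetP (nbhd_sub 1 (subsetUr _ _))).
case/nbhdP: hu => v; rewrite in_setU1 => /orP[/eqP ->|vD] d1; last first.
  by apply: sub; apply/nbhdP; exists v.
apply: sub; apply/nbhd1P.
case/hdist_le1P: d1 => [->|[j e]].
  right; exists a; apply: hD; first by rewrite flip_subset.
  exact: sw_flip_down.
have jS : j \in S.
  move: uS; rewrite e => /subsetP/(_ j); rewrite in_flip eqxx addbT.
  by case: (boolP (j \in x)) => [/(subsetP xS)//|_ /(_ isT)].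
have [jx|jx] := boolP (j \in x); last first.
  by left; apply: hD => //; rewrite e; apply: sw_flip_down.
right; exists a; apply: hD; first by rewrite flip_subset.
have ja : j != a by apply: contraNneq ax => <-.
have ju : j \notin u by rewrite e in_flip jx eqxx.
have au : a \notin u by rewrite e in_flip (negbTE ax) eq_sym (negbTE ja).
rewrite -[x](flipK j) -e; apply: sw_flip_lt2 => //.
by rewrite ltn_neqAle amin // andbT eq_sym ja.
Qed.

(* When every point below x lies in D and nothing lies strictly between x and
   its antipode, x contains min S only in dimension at most 2, where D together
   with the antipode already dominates the whole subcube. *)
Lemma nbhd_in_small S x (D : {set {set 'I_n}}) (a : 'I_n) : x \subset S -> a \in S ->
  (forall j, j \in S -> a <= j) -> a \in x ->
  sw x < sw (S :\: x) ->
  (forall z, z \subset S -> sw x < sw z -> sw (S :\: x) <= sw z) ->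
  (forall z, z \subset S -> sw z < sw x -> z \in D) ->
  nbhd_in S ((S :\: x) |: D) = powerset S.
Proof.
move=> xS aS amin ax ltxy nobetween hD.
have cardle z z' : sw z <= sw z' -> #|z'| <= #|z|.
  by have := sw_ltE z' z; lia.
apply/eqP; rewrite eqEsubset subsetIl; apply/subsetP => u; rewrite powersetE => uS.
rewrite in_nbhd_in uS /=; apply/nbhdP.
(* If [x] is all of [S], its antipode is empty; [S] minus [a] may not lie strictly between them, so
   [S] is a single point. *)
have [/eqP|] := eqVneq (S :\: x) set0.
  rewrite setD_eq0 => Sx; have e : x = S by apply/eqP; rewrite eqEsubset xS.
  subst x; rewrite setDv in nobetween *; exists set0; first by rewrite !inE eqxx.
  have aSa : flip a S \subset S by rewrite flip_subset.
  have := nobetween _ aSa; have := @sw_flip_down n a (flip a S).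
  rewrite flipK in_flip ax eqxx => /(_ isT) h1 /(_ h1) /cardle.
  rewrite cards0 flipD1 // leqn0 => c0; have := cardsD1 a S; rewrite (eqP c0) aS => cS.
  by rewrite hdistC hdist_subset ?sub0set // cards0 subn0 (leq_trans (subset_leq_card uS)) // cS.
case/set0Pn => p0 p0y.
have [M MS Mmax'] := arg_maxnP (P := fun u : 'I_n => u \in S) (@nat_of_ord n) aS.
have Mmax j : j \in S -> j <= M by move/Mmax'.
(* Exchanging [a] for [p] moves [x] up within its layer, hence to the antipode or beyond. So [x] and
   its antipode have equal size, and comparing leading binary digits shows that [p] is the maximum
   of [S]. *)
have swap p : p \in S :\: x -> p = M /\ #|S :\: x| = #|x|.
  rewrite inE => /andP[px pS]; have ap : p != a by apply: contraNneq px => ->.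
  pose z := flip p (flip a x).
  have zS : z \subset S by rewrite !flip_subset.
  have h1 : a \notin flip a x by rewrite in_flip ax eqxx.
  have h2 : p \notin flip a x by rewrite in_flip (negbTE px) (negbTE ap).
  have ltz : sw x < sw z.
    rewrite -[x](flipK a); apply: sw_flip_lt2 => //.
    by rewrite ltn_neqAle amin // andbT eq_sym ap.
  have leyz := nobetween _ zS ltz.
  have cz : #|z| = #|x|.
    by rewrite /z flipU1 // cardsU1 h2 flipD1 // [RHS](cardsD1 a) ax.
  have cy : #|S :\: x| = #|x|.
    by apply/eqP; rewrite eqn_leq cardle ?(ltnW ltxy) //= -cz cardle.
  have wxy : wt x < wt (S :\: x) by move: ltxy; rewrite sw_ltE cy ltnn eqxx.
  have wyz : wt (S :\: x) <= wt z.
    by rewrite leqNgt; move: leyz; rewrite leqNgt sw_ltE cy cz ltnn eqxx.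
  have small v : v \subset S -> M \notin v -> wt v < 2 ^ M.
    move=> vS Mv; apply: wt_lt => j jv; rewrite ltn_neqAle Mmax ?(subsetP vS) // andbT.
    by apply: contraNneq Mv => e; rewrite (_ : M = j) //; apply: val_inj.
  have big v : M \in v -> 2 ^ M <= wt v by move=> Mv; rewrite (wtD1 Mv) leq_addr.
  have My : M \in S :\: x.
    apply/negPn/negP => h; have := small _ (subsetDl S x) h.
    have : M \in x by move: h; rewrite inE MS andbT negbK.
    by move/big => h3 h4; have := leq_trans (leq_ltn_trans h3 wxy) (ltnW h4); rewrite ltnn.
  have Mz : M \in z.
    apply/negPn/negP => h; have := leq_ltn_trans (leq_trans (big _ My) wyz) (small _ zS h).
    by rewrite ltnn.
  move: My; rewrite inE => /andP[Mx _]; split=> //.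
  move: Mz; rewrite !in_flip (negbTE Mx) /=.
  have [e|_] := eqVneq M a; first by rewrite e ax in Mx.
  by move/eqP.
have yM : S :\: x = [set M].
  apply/setP => p; rewrite [RHS]inE; apply/idP/eqP => [/swap[]//|->].
  by have [<- _] := swap _ p0y.
have [_] := swap _ p0y; rewrite yM cards1 => cx.
have cS : #|S| = 2 by rewrite -(cardsID x S) (setIidPr xS) yM cards1 -cx.
(* In dimension 2 the empty set is next to the antipode, and every nonempty set is within 1 of [S],
   which precedes [x] and so lies in [D]. *)
have [u0|u1] := posnP #|u|.
  exists [set M]; rewrite ?yM ?inE ?eqxx //; move/eqP: u0; rewrite cards_eq0 => /eqP ->.
  by rewrite hdist_subset ?sub0set // cards1 cards0.
exists S; last by rewrite hdist_subset // cS; lia.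
by rewrite inE orbC hD // sw_ltE cS -cx.
Qed.

(** If [B] is not initial, some missing [x] precedes some present [y]. By compression the two agree
    nowhere on [S], so they are antipodal; hence [B] and [I] consist of the points below [x]
    together with [y] and [x] respectively. The two previous lemmas compare their neighbourhoods,
    according to whether [x] contains the minimum of [S]. *)
Lemma compressed_nbhd_in S B I : B \subset powerset S -> compressed S B ->
  initial_in (@sw n) (powerset S) I -> #|I| = #|B| -> #|nbhd_in S I| <= #|nbhd_in S B|.
Proof.
move=> BS cB hI cI; have sinj := @sw_inj n.
have [/existsP[x /existsP[y /and4P[xS xB yB lt]]]|no] :=
  boolP [exists x : {set 'I_n}, exists y : {set 'I_n}, [&& x \subset S, x \notin B, y \in B & sw x < sw y]]; last first.
  suff -> : I = B by [].
  apply: (initial_in_unique sinj hI) cI; split=> // y x yB; rewrite powersetE => xS lt.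
  apply/negPn/negP => xB; case/negP: no; apply/existsP; exists x; apply/existsP; exists y.
  by rewrite xS xB yB.
have opp u v : u \subset S -> u \notin B -> v \in B -> sw u < sw v -> v = S :\: u.
  move=> uS uB vB ltuv; apply/setP => j; rewrite inE; have [jS|jS] := boolP (j \in S).
    rewrite andbT; apply/idP/idP => h; last first.
      apply/negPn/negP => jv; case/negP: uB; apply: (cB j u v) => //.
      by rewrite (negbTE h) (negbTE jv).
    by apply/negP => ju; case/negP: uB; apply: (cB j u v) => //; rewrite ju h.
  rewrite andbF; apply/negP => jv; case/negP: jS.
  by have := subsetP BS _ vB; rewrite powersetE => /subsetP; apply.
have ey := opp _ _ xS xB yB lt.
have invx z : z \subset S -> S :\: z = S :\: x -> z = x.
  move=> zS e; apply/setP => j; have := congr1 (fun w : {set 'I_n} => j \in w) e.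
  have := subsetP zS j; have := subsetP xS j; rewrite !inE.
  by case: (j \in S); case: (j \in x); case: (j \in z) => //= h1 h2; try (by have := h1 isT); have := h2 isT.
pose D := [set z : {set 'I_n} | (z \subset S) && (sw z < sw x)].
have hD z : z \subset S -> sw z < sw x -> z \in D by rewrite inE => -> ->.
have DB : D \subset B.
  apply/subsetP => z; rewrite inE => /andP[zS ltz]; apply/negPn/negP => zB.
  have := opp _ _ zS zB yB (ltn_trans ltz lt); rewrite ey => /esym /(invx _ zS) e.
  by rewrite e ltnn in ltz.
have eB : B = y |: D.
  apply/eqP; rewrite eqEsubset subUset sub1set yB DB /= andbT; apply/subsetP => z zB.
  have zS : z \subset S by have := subsetP BS _ zB; rewrite powersetE.
  rewrite in_setU1; case: (ltngtP (sw z) (sw x)) => [l|l|/sinj e].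
  - by rewrite hD ?orbT.
  - by rewrite (opp _ _ xS xB zB l) ey eqxx.
  - by rewrite -e zB in xB.
have eI : I = x |: D.
  apply: (initial_in_unique sinj hI); last first.
    rewrite cI eB !cardsU1; congr (_ + _); rewrite !inE ltnn andbF.
    by rewrite [sw y < _]ltnNge (ltnW lt) andbF.
  split.
    apply/subsetP => z; rewrite !inE => /orP[/eqP->//|/andP[]//].
  move=> z v; rewrite !inE => hz vS ltv; rewrite vS /=.
  by case/orP: hz => [/eqP <-|/andP[_ h]]; rewrite ?ltv ?(ltn_trans ltv h) orbT.
have S0 : S != set0.
  apply: contraTneq lt => e; rewrite ey e set0D -leqNgt.
  by move: xS; rewrite e subset0 => /eqP ->.
case/set0Pn: S0 => a0 a0S.
have [a aS amin] := arg_minnP (P := fun u : 'I_n => u \in S) (@nat_of_ord n) a0S.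
have [ax|ax] := boolP (a \in x); last first.
  by rewrite eI eB; apply/subset_leq_card/(@nbhd_in_swap S x y D a).
rewrite eB ey (@nbhd_in_small S x D a) //; first exact/subset_leq_card/subsetIl.
  by rewrite -ey.
move=> z zS ltz; rewrite -ey leqNgt; apply/negP => ltzy.
have [zB|zB] := boolP (z \in B).
  by move: ltzy; rewrite (opp _ _ xS xB zB ltz) -ey ltnn.
have := opp _ _ zS zB yB ltzy; rewrite ey => /esym /(invx _ zS) e.
by rewrite e ltnn in ltz.
Qed.

(** * Compression and the induction on dimension *)

Lemma subset_sec0 S i A : A \subset powerset S -> sec0 i A \subset powerset (S :\ i).
Proof.
move/subsetP => h; apply/subsetP => x; rewrite !inE => /andP[/h].
by rewrite powersetE subsetD1 => -> ->.
Qed.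

Lemma subset_sec1 S i A : i \in S -> A \subset powerset S ->
  sec1 i A \subset powerset (S :\ i).
Proof.
move=> iS /subsetP h; apply/subsetP => x; rewrite !inE => /andP[ix /h].
by rewrite powersetE flip_subset // subsetD1 ix => ->.
Qed.

Lemma leq_card_union (T : finType) (U V U' V' : {set T}) :
  (U' \subset V') || (V' \subset U') -> #|U'| <= #|U| -> #|V'| <= #|V| ->
  #|U' :|: V'| <= #|U :|: V|.
Proof.
case/orP => [/setUidPr ->|/setUidPl ->] h1 h2.
  exact: leq_trans h2 (subset_leq_card (subsetUr _ _)).
exact: leq_trans h1 (subset_leq_card (subsetUl _ _)).
Qed.

(** Let [y] with [j] added lie in [I], and let [x] precede [y]. It suffices to add to [x] a point
    that keeps it at or below [y] with [j]: any point if [x] is larger than [y]; otherwise the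
    choice depends on where [j] lies relative to the largest difference [m] of [x] and [y]. *)
Lemma nbhd_in_initial S I : initial_in (@sw n) (powerset S) I ->
  initial_in (@sw n) (powerset S) (nbhd_in S I).
Proof.
move=> [IS Ii]; split; first exact: subsetIl.
move=> y x; rewrite !in_nbhd_in powersetE => /andP[yS yN] xS lt; rewrite xS /=.
have down u v : u \in I -> v \subset S -> sw v < sw u -> v \in I.
  by move=> uI vS; apply: Ii uI _; rewrite powersetE.
have yI_ok : y \in I -> x \in nbhd 1 I.
  by move=> yI; apply/nbhd1P; left; apply: down yI xS lt.
case/nbhd1P: yN => // -[j cI]; have [jy|jy] := boolP (j \in y).
  apply: yI_ok; apply: down cI yS _; rewrite -{1}[y](flipK j); apply: sw_flip_down.
  by rewrite in_flip jy eqxx.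
have cS : flip j y \subset S by have := subsetP IS _ cI; rewrite powersetE.
have cc : #|flip j y| = #|y|.+1 by rewrite flipU1 // cardsU1 jy.
apply/nbhd1P; move: lt; rewrite sw_ltE => /orP[lt|/andP[/eqP exy]].
  have [e|nxS] := eqVneq x S.
    left; have [e2|ne] := eqVneq (flip j y) S; first by rewrite e -e2.
    by apply: down cI xS _; rewrite sw_ltE e proper_card // properEneq ne.
  have : S :\: x != set0 by apply: contraNneq nxS => /eqP; rewrite setD_eq0 eqEsubset xS.
  case/set0Pn => i; rewrite inE => /andP[ix iS]; right; exists i.
  apply: down cI _ _; first by rewrite flip_subset.
  by rewrite sw_ltE cc flipU1 // cardsU1 ix ltnS lt.
rewrite -colex_ltE => clt; have ltxy : sw x < sw y by rewrite sw_ltE exy eqxx -colex_ltE clt orbT.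
case/existsP: clt => m /and3P[mxy /forall_inP mmax my].
have mx : m \notin x by move: mxy; rewrite in_symdiff my; case: (m \in x).
have same (k : 'I_n) : m < k -> (k \in x) = (k \in y).
  move=> lt; have := mmax k; rewrite in_symdiff leqNgt lt.
  by case: (k \in x); case: (k \in y) => // /(_ isT).
have mS : m \in S by apply: (subsetP yS).
case: (ltngtP j m) => [ltjm|ltmj|/val_inj e]; last by rewrite e my in jy.
(* If some [i] below [m] is free, adding it leaves [m] as the largest difference. If none is, [x]
   contains everything in [S] below [m], and by counting [x] with [m] equals [y] with [j]. *)
- have [/existsP[i /and3P[iS ix ltim]]|no] := boolP [exists i : 'I_n, [&& i \in S, i \notin x & i < m]].
    right; exists i; apply: down cI _ _; first by rewrite flip_subset.
    have nmj : (m == j) = false by apply/negbTE; apply: contraTneq ltjm => ->; rewrite ltnn.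
    have nmi : (m == i) = false by apply/negbTE; apply: contraTneq ltim => ->; rewrite ltnn.
    rewrite sw_ltE cc flipU1 // cardsU1 ix add1n exy eqxx ltnn /= -flipU1 //.
    apply: (@wt_lt_max n m).
    + by rewrite !(in_flip, in_symdiff) my (negbTE mx) nmi nmj.
    + move=> k; rewrite !(in_flip, in_symdiff) leqNgt; apply: contraL => ltmk.
      have /negbTE -> : k != i by apply: contraTneq ltmk => ->; rewrite -leqNgt ltnW.
      have /negbTE -> : k != j by apply: contraTneq ltmk => ->; rewrite -leqNgt ltnW.
      by rewrite same // !addbF addbb.
    + by rewrite in_flip my nmj.
  right; exists m; suff <- : flip j y = flip m x by [].
  apply/eqP; rewrite eqEcard; apply/andP; split; last first.
    by rewrite cc flipU1 // cardsU1 mx exy.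
  apply/subsetP => k kc; rewrite flipU1 // in_setU1.
  case: (ltngtP k m) => [lt|lt|/val_inj -> //]; last 2 first.
  + move: kc; rewrite in_flip same // => kc; apply/orP; right.
    suff /negbTE e : k != j by rewrite e addbF in kc.
    by apply: contraTneq lt => ->; rewrite -leqNgt ltnW.
  + by rewrite eqxx.
  apply/orP; right; apply/negPn/negP => kx; case/negP: no; apply/existsP; exists k.
  by rewrite kx lt andbT /= (subsetP cS).
- right; exists j; apply: down cI _ _.
    by rewrite flip_subset //; apply: (subsetP cS); rewrite in_flip eqxx (negbTE jy).
  by rewrite sw_flip_lt // same.
Qed.

(** Induction on the size of [S]. Among the families as large as [A] with no larger neighbourhood,
    one of least total weight is compressed: replacing both sections in a direction by initial
    segments keeps it a competitor, so by minimality changes nothing. *)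
Theorem harper_subcube S A I : A \subset powerset S ->
  initial_in (@sw n) (powerset S) I -> #|I| = #|A| -> #|nbhd_in S I| <= #|nbhd_in S A|.
Proof.
have [m] := ubnP #|S|; elim: m S A I => // m IH S A I ltm AS hI cI.
have sinj := @sw_inj n.
pose Q B := [&& B \subset powerset S, #|B| == #|A| & #|nbhd_in S B| <= #|nbhd_in S A|].
have QA : Q A by rewrite /Q AS eqxx leqnn.
have [B /and3P[BS /eqP cB leB] Bmin] := arg_minnP (P := Q) (fun B => \sum_(x in B) sw x) QA.
apply: leq_trans (leB); apply: compressed_nbhd_in => //; last by rewrite cB.
move=> i x y iS xS yB e lt.
have ltS : #|S :\ i| < m by move: ltm; rewrite (cardsD1 i S) iS.
have [hU cU] := segmentP sinj (subset_leq_card (subset_sec0 i BS)).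
have [hV cV] := segmentP sinj (subset_leq_card (subset_sec1 iS BS)).
set U := segment _ _ _ in hU cU; set V := segment _ _ _ in hV cV.
have iU u : u \in U -> i \notin u.
  by move/(subsetP hU.1); rewrite powersetE subsetD1 => /andP[].
have iV u : u \in V -> i \notin u.
  by move/(subsetP hV.1); rewrite powersetE subsetD1 => /andP[].
pose G := glue i U V.
have G0 : sec0 i G = U by apply: sec0_glue.
have G1 : sec1 i G = V by apply: sec1_glue.
have GS : G \subset powerset S.
  apply/subsetP => u; rewrite inE powersetE; case: ifP => _.
    by move/(subsetP hV.1); rewrite powersetE subsetD1 flip_subset // => /andP[].
  by move/(subsetP hU.1); rewrite powersetE subsetD1 => /andP[].
have NU := nbhd_in_initial hU; have NV := nbhd_in_initial hV.
have QG : Q G.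
  rewrite /Q GS (card_sections i G) G0 G1 cU cV -(card_sections i B) cB eqxx /=.
  apply: leq_trans (leB); rewrite (card_sections i (nbhd_in S G)) (card_sections i (nbhd_in S B)).
  rewrite !nbhd_in_sec0 // !nbhd_in_sec1 // G0 G1.
  (* In each half the neighbourhood of [G] is the union of two initial segments of one subcube.
     These are nested, so it is enough to bound each separately. *)
  apply: leq_add; apply: leq_card_union; rewrite ?cU ?cV //.
  - case/orP: (leq_total #|nbhd_in (S :\ i) U| #|V|) => h; apply/orP.
      by left; apply: (initial_in_nested sinj NU hV h).
    by right; apply: (initial_in_nested sinj hV NU h).
  - by apply: IH => //; apply: subset_sec0.
  - case/orP: (leq_total #|nbhd_in (S :\ i) V| #|U|) => h; apply/orP.
      by left; apply: (initial_in_nested sinj NV hU h).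
    by right; apply: (initial_in_nested sinj hU NV h).
  - by apply: IH => //; apply: subset_sec1.
have := Bmin _ QG; rewrite (sum_sections i B) (sum_sections i G) G0 G1.
have [le0 eq0] := initial_in_sum sinj hU (subset_sec0 i BS) cU.
have [le1 eq1] := initial_in_sum sinj hV (subset_sec1 iS BS) cV.
have shift (W : {set {set 'I_n}}) : (forall u, u \in W -> i \notin u) ->
    \sum_(u in W) sw (flip i u) + #|W| * 2 ^ n = \sum_(u in W) sw u + #|W| * 2 ^ i.
  move=> h; rewrite -!sum_nat_const -!big_split /=; apply: eq_bigr => u /h; exact: sw_flip.
have iB u : u \in sec1 i B -> i \notin u by rewrite in_sec1 => /andP[].
have := shift _ iV; have := shift _ iB; rewrite cV {shift} => s1 s2 le.
(* Lifting a section by [i] shifts its total weight by an amount depending only on its size, so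
   minimality forces equality in both section sums. *)
have [e0 e1] : U = sec0 i B /\ V = sec1 i B.
  move: le0 le1 s1 s2 le eq0 eq1; rewrite -/U -/V; clear.
  move: (\sum_(x in U) _) (\sum_(x in V) sw x) (\sum_(x in V) sw (flip i x)).
  move: (\sum_(x in sec0 i B) _) (\sum_(x in sec1 i B) sw x) (\sum_(x in sec1 i B) sw (flip i x)).
  move: (#|_| * 2 ^ n) (#|_| * 2 ^ i) => p q a b c d e f h1 h2 h3 h4 h5 h6 h7.
  by split; apply/eqP; [rewrite -h6 | rewrite -h7]; lia.
have {}e0 : initial_in (@sw n) (powerset (S :\ i)) (sec0 i B) by rewrite -e0.
have {}e1 : initial_in (@sw n) (powerset (S :\ i)) (sec1 i B) by rewrite -e1.
have [iy|iy] := boolP (i \in y).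
  have ix : i \in x by rewrite e.
  suff : flip i x \in sec1 i B by rewrite in_sec1 flipK => /andP[].
  apply: (e1.2 (flip i y)).
  - by rewrite in_sec1 flipK yB in_flip iy eqxx.
  - by rewrite powersetE subsetD1 flip_subset // xS in_flip ix eqxx.
  - by rewrite sw_flip_lt.
have ix : i \notin x by rewrite e.
suff : x \in sec0 i B by rewrite in_sec0 => /andP[].
apply: (e0.2 y) => //; first by rewrite in_sec0 yB.
by rewrite powersetE subsetD1 xS.
Qed.

End Harper.

(** * The twisting involution *)

Section Twist.
Variable n : nat.
Implicit Types (x y z u v S : {set 'I_n}) (A B C I J K : {set {set 'I_n}}) (i j : 'I_n).

Definition initial I := initial_in (@sw n) setT I.

Lemma nbhd_initial t I : initial I -> initial (nbhd t I).
Proof.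
move=> hI; elim: t => [|t IH]; first by rewrite nbhd0.
rewrite nbhdS; have := @nbhd_in_initial n setT (nbhd t I).
by rewrite /nbhd_in powersetT setTI; apply.
Qed.

(** The one-step bound iterates because [nbhd t I] is again initial, hence contained in the initial
    segment [J] as large as [nbhd t A]. *)
Theorem harper t A I : initial I -> #|I| <= #|A| -> #|nbhd t I| <= #|nbhd t A|.
Proof.
move=> hI le; elim: t => [|t IH]; first by rewrite !nbhd0.
have [J hJ cJ] := ex_initial_in (@sw n) (subset_leq_card (subsetT (nbhd t A))).
rewrite (nbhdS t I) (nbhdS t A); apply: (@leq_trans #|nbhd 1 J|).
  apply/subset_leq_card/nbhd_sub.
  by apply: (initial_in_nested (@sw_inj n) (nbhd_initial t hI) hJ); rewrite cJ.
have := @harper_subcube n setT (nbhd t A) J.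
by rewrite /nbhd_in powersetT !setTI subsetT; apply.
Qed.

Lemma compl_autE x : cube_aut 1 setT x = ~: x.
Proof.
by apply/setP => j; have := in_cube_aut 1 setT x j; rewrite perm1 => ->; rewrite !inE addbT.
Qed.

Lemma wtC x : wt x + wt (~: x) = wt [set: 'I_n].
Proof.
rewrite /wt [RHS](big_setID x) /= setTI; congr (_ + _).
by apply: eq_bigl => j; rewrite !inE andbT.
Qed.

Lemma cardC_n x : #|x| + #|~: x| = n.
Proof. by rewrite cardsC card_ord. Qed.

Lemma cardD1_n i x : #|x| = (i \in x) + #|x :\ i|.
Proof. exact: cardsD1. Qed.

Lemma sw_setC x y : sw x < sw y -> sw (~: y) < sw (~: x).
Proof.
rewrite !sw_ltE; have := wtC x; have := wtC y; have := cardC_n x; have := cardC_n y.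
move: #|x| #|y| #|~: x| #|~: y| (wt x) (wt y) (wt (~: x)) (wt (~: y)) (wt _).
lia.
Qed.

(** The antipodal map reverses [sw], as sizes and binary weights of complementary sets have constant
    sums. *)
Lemma initial_setC I : initial I -> initial (cube_aut 1 setT @: (~: I)).
Proof.
move=> [_ Ii]; split; first exact: subsetT.
move=> _ y /imsetP[x xI ->] _; rewrite compl_autE => lt.
apply/imsetP; exists (~: y); last by rewrite compl_autE setCK.
move: xI; rewrite !in_setC; apply: contra => yI.
by apply: (Ii (~: y)); rewrite ?inE //; have := sw_setC lt; rewrite setCK.
Qed.

Lemma harper_setC t A I : initial I -> #|I| = #|A| ->
  #|nbhd t (~: I)| <= #|nbhd t (~: A)|.
Proof.
move=> hI e; rewrite -(card_nbhd_cube_aut t 1 setT); apply: harper.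
  exact: initial_setC.
rewrite card_imset; last exact: cube_aut_inj.
by rewrite -(leq_add2l #|I|) cardsC e cardsC.
Qed.

(* [A_i] is the image of an initial segment under this involution. *)
Definition twist i s x := if #|x :\ i| < s then flip i x else x.

Lemma flip_D1 i x : flip i x :\ i = x :\ i.
Proof.
by apply/setP => j; rewrite !in_setD1 in_flip; case: eqVneq; rewrite ?addbF.
Qed.

Lemma twistK i s : involutive (twist i s).
Proof.
by move=> x; rewrite {2}/twist; case: ifP => h; rewrite /twist ?flip_D1 h ?flipK.
Qed.

Definition twist_set i s C := [set x : {set 'I_n} | twist i s x \in C].

Lemma in_twist_set i s C x : (x \in twist_set i s C) = (twist i s x \in C).
Proof. by rewrite inE. Qed.

Lemma twist_setE i s C : twist_set i s C = twist i s @: C.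
Proof.
have inj := inv_inj (twistK i s).
by apply/setP => x; rewrite in_twist_set -[in RHS](twistK i s x) mem_imset.
Qed.

Lemma card_twist_set i s C : #|twist_set i s C| = #|C|.
Proof. by rewrite twist_setE card_imset //; apply: inv_inj (twistK i s). Qed.

Lemma twist_setK i s : involutive (twist_set i s).
Proof. by move=> C; apply/setP => x; rewrite !in_twist_set twistK. Qed.

Definition sandwiched s C := (forall x, s < #|x| -> x \in C) /\
  (forall x, x \in C -> s <= #|x|).

Lemma card_flip_add i x : i \notin x -> #|flip i x| = #|x|.+1.
Proof. by move=> h; rewrite flipU1 // cardsU1 h. Qed.

Lemma card_flip_del i x : i \in x -> #|flip i x|.+1 = #|x|.
Proof. by move=> h; rewrite flipD1 // [RHS](cardsD1 i) h. Qed.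

Lemma card_flip_le i x : #|flip i x| <= #|x|.+1.
Proof.
have [h|h] := boolP (i \in x); last by rewrite card_flip_add.
by have := card_flip_del h; lia.
Qed.

Lemma flip_D1C i j x : j != i -> flip j x :\ i = flip j (x :\ i).
Proof.
move=> ji; apply/setP => k; rewrite !(in_flip, in_setD1).
by have [->|] := eqVneq k i; rewrite //= eq_sym (negbTE ji).
Qed.

Lemma ex_notin x : #|x| < n -> exists j, j \notin x.
Proof.
move=> lt; have : #|~: x| != 0 by have := cardC_n x; lia.
by rewrite cards_eq0 => /set0Pn[j]; rewrite inE; exists j.
Qed.

Lemma sandwiched_nbhd1 s C : s < n -> sandwiched s C -> sandwiched s.-1 (nbhd 1 C).
Proof.
move=> sn [up low]; split=> x.
  move=> lt; apply/nbhd1P; have [lt'|le] := ltnP s #|x|; first by left; apply: up.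
  have [|j jx] := @ex_notin x; first lia.
  by right; exists j; apply: up; rewrite card_flip_add //; lia.
case/nbhd1P => [/low|[j /low]]; first lia.
by have := card_flip_le j x; lia.
Qed.

(** For [s] positive, when [x] without [i] has size below [s.-1], both twists flip [x] and all its
    neighbours, and flips commute. Well above that level, membership holds on both sides. Only size
    exactly [s.-1] is delicate, where the two twists disagree. *)
Lemma nbhd1_twist i s C : s < n -> sandwiched s C ->
  nbhd 1 (twist_set i s C) = twist_set i s.-1 (nbhd 1 C).
Proof.
(* At level 0 the twist is the identity, which agrees with the truncated predecessor. *)
move=> sn [up low]; case: s sn up low => [|s] sn up low.
  have e (D : {set {set 'I_n}}) : twist_set i 0 D = D.
    by apply/setP => x; rewrite in_twist_set.
  by rewrite /= !e.
suff main (x : {set 'I_n}) :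
    (x \in nbhd 1 (twist_set i s.+1 C)) = (x \in twist_set i s (nbhd 1 C)).
  by apply/setP => x; apply: main.
rewrite in_twist_set.
have cx := cardD1_n i x.
have bigN : s < #|x| -> x \in nbhd 1 C.
  move=> lt; apply/nbhd1P; have [lt'|le] := ltnP s.+1 #|x|; first by left; apply: up.
  have [|j jx] := @ex_notin x; first lia.
  by right; exists j; apply: up; rewrite card_flip_add //; lia.
rewrite /twist; case: (ltngtP #|x :\ i| s) => [lt|gt|eq].
- have near j : #|flip j x :\ i| < s.+1.
    have [->|ji] := eqVneq j i; first by rewrite flip_D1; lia.
    by rewrite flip_D1C //; have := card_flip_le j (x :\ i); lia.
  apply/nbhd1P/nbhd1P.
    case=> [|[j]]; rewrite in_twist_set /twist; first by rewrite ltnS (ltnW lt); left.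
    by rewrite near flipC; right; exists j.
  case=> [h|[j h]]; first by left; rewrite in_twist_set /twist ltnS (ltnW lt).
  by right; exists j; rewrite in_twist_set /twist near flipC.
- have xx : twist i s.+1 x = x by rewrite /twist ltnNge gt.
  have -> : x \in nbhd 1 C by apply: bigN; lia.
  apply/nbhd1P; have [lt'|le] := ltnP s.+1 #|x|.
    by left; rewrite in_twist_set xx up.
  have ix : i \notin x by apply/negP => ix; rewrite ix in cx; lia.
  right; exists i; rewrite in_twist_set /twist flip_D1 ltnNge gt /=; apply: up.
  by rewrite card_flip_add //; lia.
(* At the critical size the old twist exchanges [x] with its flip at [i], while the new one fixes
   [x]. As both are within 1 of [x], the exchange does not affect being near the set. *)
have [ix|ix] := boolP (i \in x).
  rewrite ix in cx; have -> : x \in nbhd 1 C by apply: bigN; lia.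
  have [|j jx] := @ex_notin x; first lia.
  have ji : j != i by apply: contraNneq jx => ->.
  apply/nbhd1P; right; exists j; rewrite in_twist_set /twist flip_D1C // card_flip_add.
    by rewrite eq ltnn; apply: up; rewrite card_flip_add //; lia.
  by rewrite in_setD1 (negbTE jx) andbF.
rewrite (negbTE ix) in cx; have xC : x \notin C by apply/negP => /low; lia.
have far j : j != i -> j \notin x -> twist i s.+1 (flip j x) = flip j x.
  move=> ji jx; rewrite /twist flip_D1C // card_flip_add ?eq ?ltnn //.
  by rewrite in_setD1 (negbTE jx) andbF.
apply/nbhd1P/nbhd1P.
  case=> [|[j]]; rewrite in_twist_set.
    by rewrite /twist eq ltnSn => h; right; exists i.
  have [->|ji] := eqVneq j i.
    by rewrite /twist flip_D1 eq ltnSn flipK => h; left.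
  have [jx|jx] := boolP (j \in x); last by rewrite far // => h; right; exists j.
  have := card_flip_del jx; have := card_flip_le i (flip j x); rewrite /twist.
  by case: ifP => _ h1 h2 /low; lia.
case=> [h|[j h]]; first by rewrite h in xC.
have [e|ji] := eqVneq j i.
  by left; rewrite in_twist_set /twist eq ltnSn -e.
right; exists j; rewrite in_twist_set far //.
by apply/negP => jx; have := card_flip_del jx; have := low _ h; lia.
Qed.

Lemma nbhd_twist t i s C : s < n -> sandwiched s C ->
  nbhd t (twist_set i s C) = twist_set i (s - t) (nbhd t C) /\
  sandwiched (s - t) (nbhd t C).
Proof.
move=> sn sC; elim: t => [|t [IH1 IH2]]; first by rewrite !nbhd0 subn0.
have lt : s - t < n by lia.
rewrite (nbhdS t C) (nbhdS t (twist_set i s C)) IH1 nbhd1_twist // subnS; split=> //.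
exact: sandwiched_nbhd1.
Qed.

Lemma card_nbhd_twist t i s C : s < n -> sandwiched s C ->
  #|nbhd t (twist_set i s C)| = #|nbhd t C|.
Proof. by move=> sn sC; rewrite (nbhd_twist t i sn sC).1 card_twist_set. Qed.

Lemma flip_setC i x : flip i (~: x) = ~: flip i x.
Proof. by apply/setP => j; rewrite !(in_flip, in_setC) addNb. Qed.

Lemma coflip_autE i x : cube_aut 1 [set~ i] x = flip i (~: x).
Proof.
apply/setP => j; have := in_cube_aut 1 [set~ i] x j; rewrite perm1 => ->.
rewrite in_flip !inE; by case: (j \in x); case: (j == i).
Qed.

(** After the antipodal map, the complement of [C] is sandwiched at level [n - s]. The twist at that
    level flips [i] exactly where the twist at level [s] does not, and complementing all coordinates
    except [i] makes up the difference. *)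
Lemma card_nbhd_twist_setC t i s C : 0 < s -> s < n -> sandwiched s C ->
  #|nbhd t (~: twist_set i s C)| = #|nbhd t (~: C)|.
Proof.
move=> s0 sn [up low]; pose K := cube_aut 1 setT @: (~: C).
have inK x : (x \in K) = (~: x \notin C).
  rewrite -{1}[x]setCK -compl_autE mem_imset ?in_setC //; exact: cube_aut_inj.
have sK : sandwiched (n - s) K.
  split=> x; rewrite inK => h.
    by apply/negP => /low; have := cardC_n x; lia.
  rewrite leqNgt; apply/negP => lt; case/negP: h; apply: up; have := cardC_n x; lia.
suff eT : ~: twist_set i s C = cube_aut 1 [set~ i] @: twist_set i (n - s) K.
  rewrite eT card_nbhd_cube_aut card_nbhd_twist // ?card_nbhd_cube_aut //; lia.
apply/setP => x; have coK : flip i (~: flip i (~: x)) = x.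
  by rewrite flip_setC flipK setCK.
rewrite -[in RHS]coK -[in RHS]coflip_autE mem_imset; last exact: cube_aut_inj.
rewrite in_setC !in_twist_set inK; congr (~~ (_ \in C)).
rewrite /twist flip_D1.
have -> : (#|~: x :\ i| < n - s) = ~~ (#|x :\ i| < s).
  have := cardC_n x; have := cardD1_n i x; have := cardD1_n i (~: x); rewrite in_setC.
  by case: (i \in x) => /=; lia.
by case: (_ < s); rewrite /= ?flipK ?flip_setC !setCK.
Qed.

End Twist.

(** * Uniqueness of colex segments *)

Section Shadows.
Variable n : nat.
Implicit Types (x y Y Z : {set 'I_n}) (F C D : {set {set 'I_n}}) (i j z : 'I_n) (sigma : {perm 'I_n}).

Definition layer s : {set {set 'I_n}} := [set x : {set 'I_n} | #|x| == s].

(** The iterated lower shadow, taken directly at level [u]. *)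
Definition shadow u F := [set x : {set 'I_n} | (#|x| == u) && [exists y in F, x \subset y]].

(** The cliques of size [u] in the [s]-uniform hypergraph [F]; for [u] at least [s] they are the
    [u]-sets outside the iterated upper shadow of the [s]-sets missing from [F]. *)
Definition closure_at s u F :=
  [set x : {set 'I_n} | (#|x| == u) && [forall y : {set 'I_n}, (y \subset x) && (#|y| == s) ==> (y \in F)]].

Definition draws Y u := [set x : {set 'I_n} | (x \subset Y) && (#|x| == u)].

Lemma card_drawsE Y u : #|draws Y u| = 'C(#|Y|, u).
Proof. exact: cards_draws. Qed.

Lemma in_draws Y u x : (x \in draws Y u) = (x \subset Y) && (#|x| == u).
Proof. by rewrite inE. Qed.

Lemma shadowP u F x :
  reflect (#|x| = u /\ exists2 y, y \in F & x \subset y) (x \in shadow u F).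
Proof.
rewrite inE; apply: (iffP andP) => [[/eqP-> /exists_inP[y yF xy]]|[-> [y yF xy]]].
  by split=> //; exists y.
by split=> //; apply/exists_inP; exists y.
Qed.

Lemma closureP s u F x : reflect (#|x| = u /\ forall y, y \subset x -> #|y| = s -> y \in F)
  (x \in closure_at s u F).
Proof.
rewrite inE; apply: (iffP andP) => [[/eqP-> /forallP h]|[-> h]]; split=> //.
  by move=> y yx ys; apply: (implyP (h y)); rewrite yx ys eqxx.
by apply/forallP => y; apply/implyP => /andP[yx /eqP]; apply: h.
Qed.

Lemma ex_between x Y m : x \subset Y -> #|x| <= m -> m <= #|Y| ->
  exists2 y : {set 'I_n}, x \subset y & (y \subset Y) /\ #|y| = m.
Proof.
move=> xY xm mY; have cD : #|x| + #|Y :\: x| = #|Y|.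
  by rewrite -(cardsID x Y) (setIidPr xY).
have : 0 < #|draws (Y :\: x) (m - #|x|)| by rewrite card_drawsE bin_gt0; lia.
rewrite card_gt0 => /set0Pn[w]; rewrite in_draws => /andP[wY /eqP cw].
exists (x :|: w); first exact: subsetUl.
split; first by rewrite subUset xY (subset_trans wY) // subsetDl.
have xw : x :&: w = set0.
  apply/setP => j; rewrite !inE; apply/negP => /andP[jx /(subsetP wY)].
  by rewrite inE jx.
by rewrite cardsU xw cards0 subn0 cw subnKC.
Qed.

Lemma ex_through j Y m : j \in Y -> 0 < m -> m <= #|Y| ->
  exists2 y : {set 'I_n}, j \in y & (y \subset Y) /\ #|y| = m.
Proof.
move=> jY m0 mY; have [|||y] := @ex_between [set j] Y m; rewrite ?sub1set ?cards1 //.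
by exists y.
Qed.

Lemma flip_subset2 i x y : i \notin x -> i \notin y ->
  (flip i x \subset flip i y) = (x \subset y).
Proof.
move=> ix iy; apply/subsetP/subsetP => h j; have := h j; rewrite !in_flip;
  by have [->|] := eqVneq j i; rewrite ?addbF ?(negbTE ix) ?(negbTE iy).
Qed.

Lemma subset_U1 i x Y : i \notin x -> x \subset i |: Y -> x \subset Y.
Proof.
move=> ix h; apply/subsetP => j jx; have := subsetP h _ jx; rewrite in_setU1.
by case/orP => [/eqP e|//]; rewrite e (negbTE ix) in jx.
Qed.

(* The shape of a nonempty initial segment of colex with largest point z; the
   part not in Y is governed by the link [sec1 z F], a family of s-sets. *)
Definition coned s Y (z : 'I_n) F :=
  [/\ forall x, x \in F -> #|x| = s.+1, z \notin Y,
      forall x, x \subset Y -> #|x| = s.+1 -> x \in F &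
      forall x, x \in F -> x \subset z |: Y].

Lemma link_uniform s Y z F x : coned s Y z F -> x \in sec1 z F -> #|x| = s.
Proof.
case=> uF _ _ _; rewrite in_sec1 => /andP[zx /uF]; rewrite card_flip_add //.
by case.
Qed.

Lemma link_subset s Y z F x : coned s Y z F -> x \in sec1 z F -> x \subset Y.
Proof.
case=> _ _ _ sF; rewrite in_sec1 => /andP[zx /sF h].
apply: (subset_U1 zx); apply: subset_trans h; apply/subsetP => j jx.
by rewrite in_flip jx; have [e|//] := eqVneq j z; rewrite -e jx in zx.
Qed.

Lemma card_coned s Y z F : coned s Y z F ->
  #|F| = 'C(#|Y|, s.+1) + #|sec1 z F|.
Proof.
case=> uF zY fF sF; rewrite (card_sections z F) -card_drawsE; congr (_ + _).
suff -> : sec0 z F = draws Y s.+1 by [].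
apply/setP => x; rewrite in_sec0 in_draws; apply/andP/andP => [[xF zx]|[xY /eqP cx]].
  by rewrite (uF _ xF) eqxx (subset_U1 zx) // sF.
by rewrite fF //; split=> //; apply: contra zY => /(subsetP xY).
Qed.

Lemma card_shadow_coned s Y z F u : coned s Y z F -> u <= s -> s < #|Y| ->
  #|shadow u.+1 F| = 'C(#|Y|, u.+1) + #|shadow u (sec1 z F)|.
Proof.
case=> uF zY fF sF us sY; rewrite (card_sections z) -card_drawsE.
have -> : sec0 z (shadow u.+1 F) = draws Y u.+1.
  apply/setP => x; rewrite in_sec0 in_draws.
  apply/andP/andP => [[/shadowP[-> [y yF xy]] zx]|[xY /eqP cx]].
    by rewrite eqxx (subset_U1 zx) // (subset_trans xy) // sF.
  have [||y xy [yY cy]] := @ex_between x Y s.+1 xY; rewrite ?cx //.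
  split; last by apply: contra zY => /(subsetP xY).
  by apply/shadowP; split=> //; exists y => //; apply: fF.
suff -> : sec1 z (shadow u.+1 F) = shadow u (sec1 z F) by [].
apply/setP => x; rewrite in_sec1; apply/andP/shadowP.
  case=> zx /shadowP[]; rewrite card_flip_add // => -[cx] [y yF xy]; split=> //.
  have zy : z \in y by apply: (subsetP xy); rewrite in_flip (negbTE zx) eqxx.
  have zy' : z \notin flip z y by rewrite in_flip zy eqxx.
  exists (flip z y); first by rewrite in_sec1 flipK yF zy'.
  by rewrite -(flip_subset2 zx zy') flipK.
case=> cx [y]; rewrite in_sec1 => /andP[zy yF] xy.
have zx : z \notin x by apply: contra zy; apply: (subsetP xy).
split=> //; apply/shadowP; rewrite card_flip_add // cx; split=> //.
by exists (flip z y); rewrite ?flip_subset2.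
Qed.

(** Cliques avoiding [z] are the subsets of [Y] of the right size; those through [z] are cliques of
    the link with [z] added. With [s] positive, every vertex of a link clique lies in a member of
    the link, hence in [Y]. *)
Lemma card_closure_coned s Y z F u : coned s Y z F -> 0 < s -> s <= u ->
  #|closure_at s.+1 u.+1 F| = 'C(#|Y|, u.+1) + #|closure_at s u (sec1 z F)|.
Proof.
case=> uF zY fF sF s0 su; rewrite (card_sections z) -card_drawsE.
have -> : sec0 z (closure_at s.+1 u.+1 F) = draws Y u.+1.
  apply/setP => x; rewrite in_sec0 in_draws.
  apply/andP/andP => [[/closureP[cx h] zx]|[xY /eqP cx]].
    rewrite cx eqxx; split=> //; apply/subsetP => j jx.
    have [||y jy [yx cy]] := @ex_through j x s.+1 jx; rewrite ?cx //.
    have := subsetP (sF _ (h _ yx cy)) _ jy; rewrite in_setU1.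
    by case/orP => [/eqP e|//]; rewrite -e jx in zx.
  split; last by apply: contra zY => /(subsetP xY).
  by apply/closureP; split=> // y yx; apply: fF; apply: subset_trans xY.
suff -> : sec1 z (closure_at s.+1 u.+1 F) = closure_at s u (sec1 z F) by [].
apply/setP => x; rewrite in_sec1; apply/andP/closureP.
  case=> zx /closureP[]; rewrite card_flip_add // => -[cx] h; split=> // y yx cy.
  have zy : z \notin y by apply: contra zx; apply: (subsetP yx).
  by rewrite in_sec1 zy h // ?flip_subset2 // card_flip_add // cy.
case=> cx h.
have zx : z \notin x.
  apply/negP => zx; have [||y zy [yx cy]] := @ex_through z x s zx; rewrite ?cx //.
  by have := h _ yx cy; rewrite in_sec1 zy.
split=> //; apply/closureP; rewrite card_flip_add // cx; split=> // y yx cy.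
have [zy|zy] := boolP (z \in y).
  have zy' : z \notin flip z y by rewrite in_flip zy eqxx.
  have := h (flip z y); rewrite in_sec1 flipK => H.
  suff /andP[] : (z \notin flip z y) && (y \in F) by [].
  apply: H; first by rewrite -(flip_subset2 zy' zx) flipK.
  by have := card_flip_del zy; rewrite cy => -[].
have {}yx : y \subset x by apply: (subset_U1 zy); rewrite -flipU1.
apply: fF => //; apply/subsetP => j jy; have jx := subsetP yx _ jy.
have [||w jw [wx cw]] := @ex_through j x s jx; rewrite ?cx //.
have := h _ wx cw; rewrite in_sec1 => /andP[zw /sF/subsetP/(_ j)].
have jz : j != z by apply: contraNneq zw => <-.
by rewrite in_flip jw (negbTE jz) in_setU1 (negbTE jz) => /(_ isT).
Qed.

Definition perm_fam sigma F : {set {set 'I_n}} :=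
  (fun x : {set 'I_n} => sigma @: x) @: F.

Lemma perm_fam1 F : perm_fam 1 F = F.
Proof.
rewrite /perm_fam -[RHS]imset_id; apply: eq_imset => x.
by rewrite -[RHS]imset_id; apply: eq_imset => j; rewrite perm1.
Qed.

Lemma card_perm_fam sigma F : #|perm_fam sigma F| = #|F|.
Proof. by rewrite card_imset //; apply: imset_inj; apply: perm_inj. Qed.

(** Repeatedly swap a point of the image of [Y] outside [Z] with a point of [Z] outside that image;
    neither lies in the image of a member of [F]. *)
Lemma perm_fam_extend (sigma : {perm 'I_n}) F Y Z :
  (forall x, x \in F -> x \subset Y) -> (forall x, x \in F -> sigma @: x \subset Z) ->
  #|Y| = #|Z| ->
  exists2 tau : {perm 'I_n}, tau @: Y = Z & forall x, x \in F -> tau @: x = sigma @: x.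
Proof.
move=> FY FZ cYZ; have [m] := ubnP #|sigma @: Y :\: Z|.
elim: m sigma FZ => // m IH sigma FZ ltm.
have csY : #|sigma @: Y| = #|Z| by rewrite card_imset //; apply: perm_inj.
have [e|] := eqVneq (sigma @: Y :\: Z) set0.
  exists sigma => //; apply/eqP; rewrite eqEcard csY leqnn andbT.
  by rewrite -setD_eq0 e.
case/set0Pn => u uD; have : Z :\: sigma @: Y != set0.
  rewrite -card_gt0 cardsD setIC -csY -cardsD card_gt0; apply/set0Pn; by exists u.
case/set0Pn => v; rewrite inE => /andP[vY vZ].
have := uD; rewrite inE => /andP[uZ uY].
pose tau := (sigma * tperm u v)%g.
have tauE j : j \in Y -> sigma j != u -> tau j = sigma j.
  move=> jY ju; rewrite permM tpermD //; first by rewrite eq_sym.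
  by apply: contraNneq vY => ->; apply: imset_f.
have tauF x : x \in F -> tau @: x = sigma @: x.
  move=> xF; apply: eq_in_imset => j jx; apply: tauE; first exact: (subsetP (FY _ xF)).
  by apply: contraNneq uZ => <-; apply: (subsetP (FZ _ xF)); apply: imset_f.
have [||rho e h] := IH tau.
- by move=> x xF; rewrite tauF // FZ.
- have ltD : #|(sigma @: Y :\: Z) :\ u| < m by move: ltm; rewrite (cardsD1 u) uD.
  apply: leq_ltn_trans ltD; apply/subset_leq_card/subsetP => w.
  rewrite inE => /andP[wZ /imsetP[j jY ew]].
  have ju : sigma j != u.
    apply: contraNneq wZ => e; by rewrite ew permM e tpermL.
  rewrite tauE // in ew; rewrite in_setD1 inE wZ ew ju /=; exact: imset_f.
by exists rho => // x xF; rewrite h // tauF.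
Qed.

Lemma card_lt_ord m : m <= n -> #|[set j : 'I_n | j < m]| = m.
Proof.
move=> le; rewrite -sum1_card -[RHS](card_ord m) -sum1_card (big_ord_widen n (fun=> 1) le).
by apply: eq_bigl => j; rewrite inE.
Qed.

(** Induction on [s]. With [m] the largest point used, [C] is a cone with apex [m] over the points
    below [m]. The hypotheses give [F] the same shape over a clique [Y] of size [m]; all counts then
    split off equal binomials, so the link of [F] inherits the hypotheses. Closures are compared
    only for positive [s], since their count splits only then. *)
Theorem colex_unique s F C :
  (forall x, x \in F -> #|x| = s) ->
  initial_in (@wt n) (layer s) C -> #|F| = #|C| ->
  (forall u, u <= s -> #|shadow u F| <= #|shadow u C|) ->
  (0 < s -> forall u, s <= u -> #|closure_at s u C| <= #|closure_at s u F|) ->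
  exists sigma, perm_fam sigma F = C.
Proof.
elim: s F C => [|s IH] F C uF iC cFC hsh hcl.
  have F0 : F \subset [set set0].
    by apply/subsetP => x /uF/eqP; rewrite cards_eq0 inE.
  have C0 : C \subset [set set0].
    by apply/subsetP => x /(subsetP iC.1); rewrite !inE cards_eq0.
  exists 1%g; rewrite perm_fam1; move: F0 C0; rewrite !subset1 => /orP[]/eqP eF /orP[]/eqP eC.
  - by rewrite eF eC.
  - by move: cFC; rewrite eF eC cards1 cards0.
  - by move: cFC; rewrite eF eC cards1 cards0.
  - by rewrite eF eC.
have uC x : x \in C -> #|x| = s.+1 by move/(subsetP iC.1); rewrite inE => /eqP.
have [C0|/set0Pn[c1 c1C]] := eqVneq C set0.
  exists 1%g; rewrite perm_fam1 C0; apply/eqP; rewrite -cards_eq0 cFC C0; exact/eqP/cards0.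
have [j1 j1c1] : exists j, j \in c1.
  by apply/set0Pn; rewrite -card_gt0 uC.
pose top (j : 'I_n) := [exists c in C, j \in c].
have top1 : top j1 by apply/exists_inP; exists c1.
have [m /exists_inP[c0 c0C mc0] mmax'] := arg_maxnP (P := top) (@nat_of_ord n) top1.
have mmax c (j : 'I_n) : c \in C -> j \in c -> j <= m.
  by move=> cC jc; apply: mmax'; apply/exists_inP; exists c.
pose Z := [set j : 'I_n | j < m].
have cZ : #|Z| = m by apply: card_lt_ord; apply: ltnW.
have wtZ x : x \subset Z -> wt x < 2 ^ m.
  by move=> xZ; apply: wt_lt => j /(subsetP xZ); rewrite inE.
have coneC : coned s Z m C.
  split=> //; first by rewrite inE ltnn.
    move=> x xZ cx; apply: (iC.2 c0) => //; first by rewrite inE cx.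
    by apply: leq_trans (wtZ _ xZ) _; rewrite (wtD1 mc0) leq_addr.
  move=> x xC; apply/subsetP => j jx; have := mmax _ _ xC jx.
  by rewrite !inE leq_eqVlt => /orP[/eqP/val_inj->|->]; rewrite ?eqxx ?orbT.
have link_gt0 : 0 < #|sec1 m C|.
  rewrite card_gt0; apply/set0Pn; exists (flip m c0).
  by rewrite in_sec1 flipK c0C in_flip mc0 eqxx.
(* If [m] is at most [s], there is room for only one set, and a permutation matching two sets of
   equal size suffices. *)
have [ltsm|lems] := ltnP s m; last first.
  have one x : x \in C -> x = m |: Z.
    move=> xC; case: coneC => _ mZ _ /(_ _ xC) sx; apply/eqP; rewrite eqEcard sx.
    by rewrite (uC _ xC) cardsU1 mZ cZ.
  have eC : C = [set c0].
    apply/setP => x; rewrite inE; apply/idP/eqP => [xC|->//].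
    by rewrite (one _ xC) (one _ c0C).
  have /cards1P[d ed] : #|F| == 1 by rewrite cFC eC cards1.
  have cd : #|d| = #|c0| by rewrite (uC _ c0C) uF // ed inE.
  have [||tau td _] := @perm_fam_extend 1 set0 d c0 _ _ cd; try by move=> x; rewrite inE.
  by exists tau; rewrite /perm_fam ed imset_set1 td eC.
have Zcl : Z \in closure_at s.+1 m C.
  by apply/closureP; split=> // y yZ; case: coneC => _ _ h _; apply: h.
have : 0 < #|closure_at s.+1 m F|.
  by apply: leq_trans (hcl isT m ltsm); rewrite card_gt0; apply/set0Pn; exists Z.
rewrite card_gt0 => /set0Pn[Y /closureP[cY YF]].
pose supp := [set j : 'I_n | [set j] \in shadow 1 F].
(* The shadow at level 1 counts the points used, and [C] uses at most [m.+1] of them. *)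
have csupp : #|supp| <= m.+1.
  apply: (@leq_trans #|shadow 1 F|).
    rewrite -(card_imset _ (@set1_inj _)); apply/subset_leq_card/subsetP => _ /imsetP[j jS ->].
    by rewrite inE in jS.
  apply: leq_trans (hsh 1 isT) _; rewrite (card_shadow_coned coneC) ?cZ // bin1 -addn1 leq_add2l.
  rewrite -(cards1 (set0 : {set 'I_n})); apply/subset_leq_card/subsetP => x /shadowP[/eqP].
  by rewrite cards_eq0 inE.
have suppF x j : x \in F -> j \in x -> j \in supp.
  by move=> xF jx; rewrite inE; apply/shadowP; rewrite cards1; split=> //; exists x; rewrite ?sub1set.
have Ysupp : Y \subset supp.
  apply/subsetP => j jY; have [||y jy [yY cy]] := @ex_through j Y s.+1 jY; rewrite ?cY //.
  by apply: suppF jy; apply: YF.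
(* Were [F] supported on [Y], it would be smaller than [C], whose link at [m] is nonempty. *)
have /subsetPn[z zsupp zY] : ~~ (supp \subset Y).
  apply/negP => no; have : #|F| <= 'C(#|Y|, s.+1).
    rewrite -card_drawsE; apply/subset_leq_card/subsetP => x xF; rewrite in_draws uF // eqxx andbT.
    by apply/subsetP => j jx; apply: (subsetP no); apply: suppF jx.
  by rewrite cY cFC (card_coned coneC) cZ -[X in _ <= X]addn0 leq_add2l leqNgt link_gt0.
have esupp : z |: Y = supp.
  apply/eqP; rewrite eqEcard subUset sub1set zsupp Ysupp /=.
  by rewrite cardsU1 zY cY.
have coneF : coned s Y z F.
  by split=> // x xF; rewrite esupp; apply/subsetP => j; apply: suppF.
have cL : #|sec1 z F| = #|sec1 m C|.
  by move: cFC; rewrite (card_coned coneF) (card_coned coneC) cY cZ => /addnI.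
have [|||||sigma sF] := IH (sec1 z F) (sec1 m C).
- by move=> x; apply: link_uniform coneF.
- split; first by apply/subsetP => x /(link_uniform coneC); rewrite inE => ->.
  move=> x y xL; rewrite inE => /eqP cy lt.
  have wx := wtZ _ (link_subset coneC xL).
  have my : m \notin y.
    by apply/negP => my; have := ltn_trans lt wx; rewrite (wtD1 my) -ltn_subRL subnn.
  move: xL; rewrite !in_sec1 my => /andP[mx xC]; apply: (iC.2 (flip m x)) => //.
    by rewrite inE card_flip_add // cy.
  by rewrite !flipU1 // !wtU1 // ltn_add2l.
- exact: cL.
- move=> u us; have := hsh u.+1 us.
  by rewrite (card_shadow_coned coneF) ?cY // (card_shadow_coned coneC) ?cZ // leq_add2l.
- move=> s0 u us; have := hcl isT u.+1 us.
  by rewrite (card_closure_coned coneF) // (card_closure_coned coneC) // cY cZ leq_add2l.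
have [|||tau tY tF] := @perm_fam_extend sigma (sec1 z F) Y Z.
- by move=> x; apply: link_subset coneF.
- move=> x xL; apply: (link_subset coneC); rewrite -sF; exact: imset_f.
- by rewrite cY cZ.
(* This sends [z] to [m] and agrees with [tau] on [Y], because [Z] contains neither [tau z] nor
   [m]. *)
pose rho := (tau * tperm (tau z) m)%g.
have rY j : j \in Y -> rho j = tau j.
  move=> jY; have jZ : tau j \in Z by rewrite -tY imset_f.
  rewrite permM tpermD //; first by rewrite (inj_eq perm_inj); apply: contraNneq zY => ->.
  by apply: contraTneq jZ => <-; rewrite inE ltnn.
have rz : rho z = m by rewrite permM tpermL.
exists rho; apply/eqP; rewrite eqEcard card_perm_fam cFC leqnn andbT.
apply/subsetP => _ /imsetP[x xF ->].
have [zx|zx] := boolP (z \in x).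
  have zx' : z \notin flip z x by rewrite in_flip zx eqxx.
  have xL : flip z x \in sec1 z F by rewrite in_sec1 flipK zx' xF.
  have : tau @: flip z x \in sec1 m C.
    by rewrite tF // -sF; apply: imset_f.
  have -> : tau @: flip z x = rho @: flip z x.
    by apply: eq_in_imset => j jx; rewrite rY // (subsetP (link_subset coneF xL)).
  rewrite in_sec1 => /andP[mx]; rewrite flipU1 // => h.
  suff -> : rho @: x = m |: rho @: flip z x by [].
  by rewrite -rz -imsetU1 -flipU1 // flipK.
have xY : x \subset Y by apply: (subset_U1 zx); case: coneF => _ _ _; apply.
have -> : rho @: x = tau @: x by apply: eq_in_imset => j jx; rewrite rY // (subsetP xY).
case: coneC => _ _ full _; apply: full; first by rewrite -tY imsetS.
by rewrite card_imset ?uF //; apply: perm_inj.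
Qed.

End Shadows.

(** * Sets between two consecutive Hamming balls *)

Section Capped.
Variable n : nat.
Implicit Types (x y p Y Z : {set 'I_n}) (A B F C D : {set {set 'I_n}}) (i j z : 'I_n)
  (sigma : {perm 'I_n}).

(** For [s < n], the ball of radius [n - s - 1] around the full set. *)
Definition above s : {set {set 'I_n}} := [set x : {set 'I_n} | s < #|x|].
Definition capped s F := above s :|: F.
Definition uniform s F := forall x, x \in F -> #|x| = s.

Lemma in_above s x : (x \in above s) = (s < #|x|).
Proof. by rewrite inE. Qed.

Lemma card_layer s : #|layer n s| = 'C(n, s).
Proof.
by rewrite card_draws card_ord.
Qed.

Lemma card_below m : #|[set x : {set 'I_n} | #|x| < m]| = \sum_(j < m) 'C(n, j).
Proof.
elim: m => [|m IH].
  by rewrite big_ord0; apply/eqP; rewrite cards_eq0; apply/eqP/setP => x; rewrite !inE.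
rewrite big_ord_recr /= -IH -card_layer.
rewrite -[LHS](cardsID [set x : {set 'I_n} | #|x| < m]); congr (_ + _); apply: eq_card => x; rewrite !inE.
  by rewrite ltnS andb_idl // => /ltnW.
by rewrite ltnS -leqNgt eqn_leq andbC.
Qed.

Lemma card_above r : r < n -> #|above (n - r - 1)| = f_r n r.
Proof.
move=> rn; rewrite /f_r -card_below -(card_imset _ (@setC_inj _)); apply: eq_card => x.
rewrite -[x]setCK mem_imset; last exact: setC_inj.
by rewrite in_above inE setCK; have := cardC_n x; lia.
Qed.

Lemma card_capped s F : uniform s F -> #|capped s F| = #|above s| + #|F|.
Proof.
move=> uF; rewrite cardsU -[RHS]subn0; congr (_ - _).
apply/eqP; rewrite cards_eq0; apply/eqP/setP => x; rewrite in_set0 in_setI in_above.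
by apply/negP => /andP[lt /uF e]; rewrite e ltnn in lt.
Qed.

Lemma sandwiched_capped s F : uniform s F -> sandwiched s (capped s F).
Proof.
move=> uF; split=> x; first by rewrite in_setU in_above => ->.
by rewrite in_setU in_above => /orP[/ltnW//|/uF ->].
Qed.

Lemma cappedE s D : sandwiched s D -> D = capped s (D :&: layer n s).
Proof.
move=> [up low]; apply/setP => x; rewrite in_setU in_setI in_above [x \in layer _ _]inE.
by case: (ltngtP s #|x|) => [/up->|lt|//]; rewrite ?andbT ?andbF //;
  apply/negP => /low; rewrite leqNgt lt.
Qed.

Lemma colex_initE s k : colex_init n s k = segment (@wt n) (layer n s) k.
Proof.
apply/setP => x; rewrite !inE; congr (_ && (_ < k)); apply: eq_card => y.
by rewrite !inE colex_ltE.
Qed.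

Lemma initial_capped s F : initial_in (@wt n) (layer n s) F -> initial (capped s F).
Proof.
move=> [Fs Fi]; split; first exact: subsetT.
have uF x : x \in F -> #|x| = s by move/(subsetP Fs); rewrite inE => /eqP.
move=> x y; rewrite !in_setU !in_above sw_ltE => hx _ hy.
case/orP: hx => [lt|xF].
  apply/orP; left; case/orP: hy => [|/andP[/eqP-> //]]; exact: ltn_trans.
case/orP: hy => [|/andP[/eqP e lt]]; first by rewrite (uF _ xF) => ->.
by rewrite (Fi x y) ?orbT // inE e uF.
Qed.

Lemma hdist_subsetP x y : #|x| + hdist x y <= #|y| -> x \subset y.
Proof.
move=> le; rewrite -setD_eq0 -cards_eq0.
have e : hdist x y = #|x :\: y| + #|y :\: x|.
  rewrite /hdist /symdiff cardsU; suff -> : (x :\: y) :&: (y :\: x) = set0 by rewrite cards0 subn0.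
  by apply/setP => j; rewrite !inE; case: (j \in x); case: (j \in y).
have e1 : #|x| = #|x :&: y| + #|x :\: y| by rewrite cardsID.
have e2 : #|y| = #|x :&: y| + #|y :\: x| by rewrite setIC cardsID.
move: le; rewrite e e1 e2; lia.
Qed.

Lemma nbhd_capped t s F : s < n -> uniform s F -> t <= s ->
  nbhd t (capped s F) = capped (s - t) (shadow (s - t) F).
Proof.
move=> sn uF ts; suff main x : (x \in nbhd t (capped s F)) =
    (x \in capped (s - t) (shadow (s - t) F)) by apply/setP => x; apply: main.
rewrite in_setU in_above; apply/nbhdP/orP => [[y]|[lt|/shadowP[cx [y yF xy]]]].
- have le := card_leq_hdist y x; rewrite hdistC in le.
  rewrite in_setU in_above => /orP[lt|yF] h; first by left; lia.
  have cy := uF _ yF; have [lt|ge] := ltnP (s - t) #|x|; first by left.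
  right; apply/shadowP; split; first by lia.
  by exists y => //; apply: hdist_subsetP; lia.
- have [lt'|le] := ltnP s #|x|.
    by exists x; rewrite ?hdistxx // in_setU in_above lt'.
  have [|||y xy [_ cy]] := @ex_between n x setT s.+1; rewrite ?subsetT ?cardsT ?card_ord //.
    exact: leqW.
  exists y; first by rewrite in_setU in_above cy ltnSn.
  by rewrite hdist_subset // cy; lia.
- exists y; first by rewrite in_setU yF orbT.
  by rewrite hdist_subset // (uF _ yF) cx; lia.
Qed.

(** The left side consists of the centres of [t]-balls contained in [capped s F]. At size [s + t],
    the only points of such a ball not above level [s] are the [s]-subsets of the centre. *)
Lemma nbhd_setC_capped t s F : 0 < s -> uniform s F ->
  ~: nbhd t (~: capped s F) = capped (s + t) (closure_at s (s + t) F).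
Proof.
move=> s0 uF; suff main x : (x \in ~: nbhd t (~: capped s F)) =
    (x \in capped (s + t) (closure_at s (s + t) F)) by apply/setP => x; apply: main.
have -> : (x \in ~: nbhd t (~: capped s F)) =
    [forall y : {set 'I_n}, (hdist x y <= t) ==> (y \in capped s F)].
  rewrite in_setC; apply/idP/forallP => [h y|h].
    apply/implyP => hy; apply/negPn/negP => yD; case/negP: h; apply/nbhdP; exists y => //.
    by rewrite in_setC.
  by apply/nbhdP => -[y]; rewrite in_setC => yD hy; have := h y; rewrite hy (negbTE yD).
rewrite in_setU in_above; apply/forallP/orP => [h|h y].
  have [lt|le] := ltnP (s + t) #|x|; [by left | right].
  have near y : y \subset x -> #|x| <= #|y| + t -> y \in capped s F.
    move=> yx le'; apply: (implyP (h y)); rewrite hdistC hdist_subset //; lia.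
  have cx : #|x| = s + t.
    apply/eqP; rewrite eqn_leq le leqNgt; apply/negP => lt.
    (* Removing up to [t] points takes a smaller [x] below level [s]; if the subtraction truncates,
       [0 < s] still gives this. *)
    have [|||y _ [yx cy]] := @ex_between n set0 x (#|x| - t); rewrite ?sub0set ?cards0 //; first by lia.
    have := (sandwiched_capped uF).2 y; rewrite near // ?cy; last by lia.
    by move/(_ isT); lia.
  apply/closureP; split=> // y yx cy; have := near y yx; rewrite cx cy => /(_ (leqnn _)).
  by rewrite in_setU in_above cy ltnn.
apply/implyP => hy; have le := card_leq_hdist x y; rewrite in_setU in_above.
have [//|le' /=] := ltnP s #|y|; case: h => [lt|/closureP[cx hF]]; first by lia.
apply: hF; last by lia.
by apply: hdist_subsetP; rewrite hdistC; lia.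
Qed.

(** The twist removes [i] from the members of the colex segment that contain it, giving the part
    [Ai0], and fixes the other members and everything larger. *)
Lemma A_iE r k i : A_i r k i =
  twist_set i (n - r - 1) (capped (n - r - 1) (colex_init n (n - r - 1) k)).
Proof.
rewrite /A_i; set s := n - r - 1; set F := colex_init n s k.
have uF x : x \in F -> #|x| = s by rewrite inE => /andP[/eqP].
clearbody F; suff main x :
    (s < #|x|) || (i \notin x) && (x \in F) || [&& i \notin x, #|x|.+1 == s & i |: x \in F]
    = (twist i s x \in capped s F).
  by apply/setP => x; rewrite in_twist_set -main !inE.
rewrite in_setU in_above /twist; have cx := cardD1_n i x.
have [ix|ix] := boolP (i \in x).
  rewrite /= !orbF; rewrite ix in cx; case: (ltnP #|x :\ i| s) => h.
    have cf := card_flip_del ix; have -> : (s < #|x|) = false by lia.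
    have -> : (s < #|flip i x|) = false by lia.
    by apply/esym/negP => /uF; lia.
  by have -> : (s < #|x|) by lia.
rewrite (negbTE ix) add0n in cx; rewrite /= -cx.
have cf := card_flip_add ix; case: (ltnP #|x| s) => h.
  have -> : (s < #|x|) = false by lia.
  have -> : (x \in F) = false by apply/negP => /uF; lia.
  have -> : (s < #|flip i x|) = false by lia.
  rewrite flipU1 //=; apply/andP/idP => [[]//|xF]; split=> //.
  by have := uF _ xF; rewrite -flipU1 // cf => ->.
have -> : (#|x|.+1 == s) = false by lia.
by rewrite orbF.
Qed.

(** * Action of permutations on twists and capped families *)

Lemma imset_flip sigma i x : sigma @: flip i x = flip (sigma i) (sigma @: x).
Proof.
apply/setP => j; rewrite -[j](permKV sigma) in_flip !mem_imset; try exact: perm_inj.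
by rewrite in_flip (inj_eq perm_inj).
Qed.

Lemma cube_aut0 sigma x : cube_aut sigma set0 x = sigma @: x.
Proof. by rewrite /cube_aut /symdiff setD0 set0D setU0. Qed.

Lemma cube_aut_comp sigma p x :
  cube_aut sigma set0 (cube_aut 1 p x) = cube_aut sigma (sigma @: p) x.
Proof.
rewrite cube_aut0; apply/setP => j; rewrite -[j](permKV sigma) in_cube_aut.
rewrite !mem_imset; try exact: perm_inj.
by have := in_cube_aut 1 p x (sigma^-1%g j); rewrite perm1.
Qed.

Lemma imset_twist sigma i s x :
  sigma @: twist i s x = twist (sigma i) s (sigma @: x).
Proof.
have e : sigma @: x :\ sigma i = sigma @: (x :\ i).
  apply/setP => j; rewrite -[j](permKV sigma) in_setD1 !mem_imset; try exact: perm_inj.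
  by rewrite in_setD1 (inj_eq perm_inj).
rewrite /twist e card_imset; last exact: perm_inj.
by case: ifP => _; rewrite ?imset_flip.
Qed.

Lemma twist_set_perm sigma i s C :
  cube_aut sigma set0 @: twist_set i s C = twist_set (sigma i) s (cube_aut sigma set0 @: C).
Proof.
rewrite !twist_setE -!imset_comp; apply: eq_imset => x /=.
by rewrite !cube_aut0 imset_twist.
Qed.

Lemma capped_perm sigma s F :
  cube_aut sigma set0 @: capped s F = capped s (perm_fam sigma F).
Proof.
rewrite imsetU; congr (_ :|: _); last by apply: eq_imset => x; rewrite cube_aut0.
apply/setP => x; apply/imsetP/idP => [[y]|].
  by rewrite !in_above => lt ->; rewrite cube_aut0 card_imset //; apply: perm_inj.
rewrite in_above => lt; exists (sigma^-1%g @: x).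
  by rewrite in_above card_imset //; apply: perm_inj.
rewrite cube_aut0 -imset_comp -[LHS]imset_id; apply: eq_imset => j /=.
by rewrite permKV.
Qed.

End Capped.

(** * Extremal sets *)

Section Extremal.
Variable n : nat.
Implicit Types (x y p : {set 'I_n}) (A B F C D : {set {set 'I_n}}) (i j top : 'I_n)
  (sigma : {perm 'I_n}).

Lemma colex_init_initial s k : k <= 'C(n, s) ->
  initial_in (@wt n) (layer n s) (colex_init n s k) /\ #|colex_init n s k| = k.
Proof.
by move=> le; rewrite colex_initE; apply: segmentP; [exact: wt_inj | rewrite card_layer].
Qed.

Lemma colex_init_uniform s k : uniform s (colex_init n s k).
Proof. by move=> x; rewrite inE => /andP[/eqP]. Qed.

Lemma leq_bin_pred m : 'C(n.-1, m) <= 'C(n, m).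
Proof. by case: n m => [|p] [|m] //; rewrite ?bin0 // binS leq_addr. Qed.

(** The [s]-sets avoiding the last coordinate form an initial segment of size ['C(n.-1, s)]. This is
    where the upper bound on the size of the extremal set enters. *)
Lemma colex_init_notin_top s k top x : top = n.-1 :> nat -> k <= 'C(n.-1, s) ->
  x \in colex_init n s k -> top \notin x.
Proof.
move=> etop le xC; have [iC cC] := colex_init_initial (leq_trans le (leq_bin_pred s)).
have notop y : top \notin y -> wt y < 2 ^ top.
  move=> ty; apply: wt_lt => j jy; have : j != top by apply: contraNneq ty => <-.
  by rewrite -val_eqE /= etop; have := ltn_ord j; lia.
pose G := draws [set~ top] s.
have iG : initial_in (@wt n) (layer n s) G.
  split; first by apply/subsetP => y; rewrite in_draws inE => /andP[].
  move=> u y; rewrite !in_draws [y \in _]inE => /andP[uT _] -> lt; rewrite andbT.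
  apply/subsetP => j jy; rewrite !inE; apply: contraTneq lt => ej.
  rewrite -leqNgt; apply: ltnW; apply: leq_trans (notop u _) _.
    by apply/negP => /(subsetP uT); rewrite !inE eqxx.
  by rewrite -ej (wtD1 jy) leq_addr.
have cG : #|G| = 'C(n.-1, s).
  by rewrite card_drawsE cardsC1 card_ord.
have : x \in G by apply: (subsetP (initial_in_nested (@wt_inj n) iC iG _)) xC; rewrite cC cG.
by rewrite in_draws => /andP[/subsetP xT _]; apply/negP => /xT; rewrite !inE eqxx.
Qed.

(** Points above level [s] are fixed. A point [x] below it in the twisted set would have its flip in
    [A], at distance [#|x|] from the singleton of [i], the flip of the empty set. *)
Lemma sandwiched_twist s i A : 0 < s -> above n s \subset A ->
  [set i] \notin nbhd s.-1 A -> sandwiched s (twist_set i s A).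
Proof.
move=> s0 /subsetP up iA; split=> x; rewrite in_twist_set /twist; have cx := cardD1_n i x.
  move=> lt; have le : s <= #|x :\ i| by lia.
  by rewrite ltnNge le /= up // in_above.
move=> h; rewrite leqNgt; apply/negP => lt; case/negP: iA; apply/nbhdP.
have lt' : #|x :\ i| < s by lia.
exists (flip i x); first by rewrite lt' in h.
have -> : [set i] = flip i set0 by rewrite flipU1 ?inE // setU0.
by rewrite hdist_flip2 hdist_subset ?sub0set // cards0 subn0; lia.
Qed.

Lemma nbhd_set0 t : nbhd t (set0 : {set {set 'I_n}}) = set0.
Proof. by apply/setP => x; rewrite in_set0; apply/nbhdP => -[y]; rewrite inE. Qed.

Lemma extremal_setT : extremal [set: {set 'I_n}].
Proof.
move=> t _; split=> B cB; last by rewrite setCT nbhd_set0 cards0.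
suff -> : B = setT by [].
by apply/eqP; rewrite eqEcard subsetT cB leqnn.
Qed.

Lemma card_nbhd_iso t A D sigma p : cube_aut sigma p @: A = D ->
  #|nbhd t A| = #|nbhd t D| /\ #|nbhd t (~: A)| = #|nbhd t (~: D)|.
Proof. by move=> <-; rewrite -cube_aut_setC !card_nbhd_cube_aut. Qed.

Lemma extremal_twist_initial s i C A : 0 < s -> s < n -> sandwiched s C -> initial C ->
  cube_iso A (twist_set i s C) -> extremal A.
Proof.
move=> s0 sn sC iC [sigma [p e]] t _; have [e1 e2] := card_nbhd_iso t e.
have cA : #|A| = #|C|.
  by rewrite -(card_twist_set i s C) -e card_imset //; apply: cube_aut_inj.
split=> B cB.
  by rewrite e1 card_nbhd_twist //; apply: harper; rewrite // cB cA.
rewrite e2 card_nbhd_twist_setC // -[B]setCK; apply: harper_setC => //.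
apply/eqP; rewrite -(eqn_add2r #|B|) -[in X in _ == X](addnC #|B|) cardsC cB -cA.
by rewrite cardsC.
Qed.

(* Compared with C, an extremal A leaves a point at distance more than r from
   its complement, hence contains a ball of radius r. *)
Lemma extremal_contains_ball r A C : r < n -> above n (n - r - 1) \subset C ->
  #|nbhd r (~: A)| <= #|nbhd r (~: C)| ->
  exists p, above n (n - r - 1) \subset cube_aut 1 p @: A.
Proof.
move=> rn upC le.
have TC : setT \notin nbhd r (~: C).
  apply/nbhdP => -[y]; rewrite in_setC => yC; rewrite hdistC hdist_subset ?subsetT //.
  rewrite cardsT card_ord => h; case/negP: yC; apply: (subsetP upC).
  by rewrite in_above; lia.
have : nbhd r (~: A) != setT.
  apply: contraNneq TC => e; suff -> : nbhd r (~: C) = setT by rewrite inE.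
  by apply/eqP; rewrite eqEcard subsetT -e.
rewrite -subTset => /subsetPn[p _ pA]; exists (~: p).
apply/subsetP => x; rewrite in_above => lt.
have autp : cube_aut 1 (~: p) p = setT.
  apply/setP => j; have := in_cube_aut 1 (~: p) p j; rewrite perm1 => ->.
  by rewrite !inE addbN addbb.
have /codomP[y ey] := injF_onto (@cube_aut_inj n 1 (~: p)) x.
rewrite ey mem_imset; last exact: cube_aut_inj.
apply/negPn/negP => yA; case/negP: pA; apply/nbhdP; exists y; first by rewrite in_setC.
rewrite -(hdist_cube_aut 1 (~: p)) autp -ey hdistC hdist_subset ?subsetT // cardsT card_ord.
lia.
Qed.

(** The neighbourhood of the capped family misses the empty set and the singleton of [top], so that
    of [A] misses two points. It contains all sets of size at least 2, hence one of the missed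
    points is a singleton. *)
Lemma extremal_avoids_ball s A F top : 0 < s -> s < n -> above n s \subset A ->
  uniform s F -> (forall x, x \in F -> top \notin x) ->
  #|nbhd s.-1 A| <= #|nbhd s.-1 (capped s F)| ->
  exists i, [set i] \notin nbhd s.-1 A.
Proof.
move=> s0 sn upA uF topF le.
have ss : s - s.-1 = 1 by lia.
have sub : above n 1 \subset nbhd s.-1 A.
  have u0 : uniform s (set0 : {set {set 'I_n}}) by move=> x; rewrite inE.
  have := nbhd_capped (t := s.-1) sn u0 (leq_pred s); rewrite ss {1}/capped setU0 => e.
  by apply: subset_trans (nbhd_sub s.-1 upA); rewrite e subsetUl.
have : 1 < #|~: nbhd s.-1 A|.
  have : 1 < #|~: nbhd s.-1 (capped s F)|.
    have ne : set0 != [set top] by rewrite eq_sym -card_gt0 cards1.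
    have <- : #|[set (set0 : {set 'I_n}); [set top]]| = 2 by rewrite cards2 ne.
    apply/subset_leq_card/subsetP => x; rewrite in_setC (nbhd_capped sn uF (leq_pred s)) ss.
    rewrite in_set2 in_setU in_above => /orP[]/eqP ->; apply/negP => /orP[].
    - by rewrite cards0.
    - by case/shadowP; rewrite cards0.
    - by rewrite cards1.
    - by case/shadowP => _ [y /topF ty]; rewrite sub1set (negbTE ty).
  move=> h; apply: leq_trans h _.
  by rewrite -(leq_add2l #|nbhd s.-1 A|) cardsC -(cardsC (nbhd s.-1 (capped s F))) leq_add2r.
rewrite (cardsD1 set0) => h.
have : 0 < #|~: nbhd s.-1 A :\ set0| by rewrite -ltnS (leq_trans h) // -add1n leq_add2r leq_b1.
rewrite card_gt0 => /set0Pn[x]; rewrite in_setD1 in_setC => /andP[x0 xA].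
have /cards1P[i ei] : #|x| == 1.
  rewrite eqn_leq card_gt0 x0 andbT leqNgt; apply: contra xA => lt.
  by apply: (subsetP sub); rewrite in_above.
by exists i; rewrite -ei.
Qed.

Lemma sandwiched_colex_iso s k D : 0 < s -> s < n -> k <= 'C(n, s) -> sandwiched s D ->
  #|D| = #|capped s (colex_init n s k)| ->
  (forall t, #|nbhd t D| <= #|nbhd t (capped s (colex_init n s k))|) ->
  (forall t, #|nbhd t (~: D)| <= #|nbhd t (~: capped s (colex_init n s k))|) ->
  exists sigma, cube_aut sigma set0 @: D = capped s (colex_init n s k).
Proof.
move=> s0 sn le sD cD hN hC; have [iC cC] := colex_init_initial le.
set C := colex_init n s k in cD hN hC iC cC *.
have uC : uniform s C := @colex_init_uniform s k.
pose F := D :&: layer n s; have eD : D = capped s F := cappedE sD.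
have uF : uniform s F by move=> x; rewrite in_setI [_ \in layer _ _]inE => /andP[_ /eqP].
have ushadow u G : uniform u (shadow u G) by move=> x /shadowP[].
have uclosure v u G : uniform u (closure_at v u G) by move=> x /closureP[].
have [|||sigma eF] := @colex_unique n s F C uF iC.
- by apply/eqP; rewrite -(eqn_add2l #|above n s|) -!card_capped // -eD cD.
(* Radius [s - u] isolates the shadow at level [u]; below, radius [u - s] around the complement
   isolates the closure. *)
- move=> u us; have := hN (s - u); rewrite eD !nbhd_capped ?leq_subr // !subKn //.
  by rewrite !card_capped // leq_add2l.
- move=> _ u us; have := hC (u - s); rewrite eD.
  rewrite -[nbhd _ (~: capped s F)]setCK -[nbhd _ (~: capped s C)]setCK.
  rewrite !nbhd_setC_capped // subnKC // => h.
  rewrite -(leq_add2l #|above n u|) -!card_capped //.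
  rewrite -(leq_add2r #|~: capped u (closure_at s u F)|) cardsC.
  by rewrite -(cardsC (capped u (closure_at s u C))) leq_add2l.
by exists sigma; rewrite eD capped_perm eF.
Qed.

End Extremal.

(** * Characterisation of extremal sets *)

Theorem theorem2 (n r : nat) (A : {set {set 'I_n}}) :
  1 <= n -> r <= n - 1 ->
  f_r n r < #|A| <= g_r n r ->
  (extremal A <->
   exists i : 'I_n, cube_iso A (A_i r (#|A| - f_r n r) i)).
Proof.
move=> n1 rn /andP[ltA leA]; have rn' : r < n by lia.
set k := #|A| - f_r n r; set s := n - r - 1.
have kle : k <= 'C(n.-1, s).
  have -> : s = n.-1 - r by rewrite /s; lia.
  by rewrite bin_sub /k; [move: leA; rewrite /g_r; lia | lia].
have kle' := leq_trans kle (leq_bin_pred n s).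
have [iC cC] := colex_init_initial kle'.
have uC := @colex_init_uniform n s k.
have cap : #|capped s (colex_init n s k)| = #|A|.
  by rewrite card_capped // cC card_above // /k subnKC // ltnW.
have sC := sandwiched_capped uC.
have topP : n.-1 < n by lia.
pose top := Ordinal topP.
(* When [s] is 0, [f_r n r] is one less than the size of the cube, so [A] is everything. *)
have [s0|s0] := posnP s.
  have eT (D : {set {set 'I_n}}) : #|D| = #|A| -> D = setT.
    move=> cD; apply/eqP; rewrite eqEcard subsetT cD.
    apply: leq_trans ltA; rewrite -card_above // -/s s0 (cardsD1 set0) inE add1n ltnS.
    apply/subset_leq_card/subsetP => x; rewrite in_setD1 in_above => /andP[x0 _].
    by rewrite card_gt0.
  have eA := eT A erefl; split=> _; last by rewrite eA; apply: extremal_setT.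
  exists top, 1%g, set0; rewrite A_iE -/s [RHS]eT ?card_twist_set //.
  apply: eT; rewrite card_imset //; exact: cube_aut_inj.
have sn : s < n by lia.
have iCap := initial_capped iC.
split=> [ext|[i]]; last first.
  by rewrite A_iE -/s; apply: extremal_twist_initial.
have hN t : #|nbhd t A| <= #|nbhd t (capped s (colex_init n s k))|.
  case: t => [|t]; first by rewrite !nbhd0 cap.
  by have [h _] := ext t.+1 isT; apply: h.
have hC t : #|nbhd t (~: A)| <= #|nbhd t (~: capped s (colex_init n s k))|.
  have cc : #|~: capped s (colex_init n s k)| = #|~: A|.
    by apply/eqP; rewrite -(eqn_add2l #|A|) cardsC -cap cardsC.
  case: t => [|t]; first by rewrite !nbhd0 cc.
  by have [_ h] := ext t.+1 isT; apply: h.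
have [p upA] := extremal_contains_ball rn' (subsetUl _ _) (hC r).
set A1 := cube_aut 1 p @: A in upA.
have card1 t := card_nbhd_iso t (erefl A1).
have [i iA] : exists i, [set i] \notin nbhd s.-1 A1.
  apply: (@extremal_avoids_ball n s A1 (colex_init n s k) top) => //.
    by move=> x; apply: colex_init_notin_top kle.
  by have [<- _] := card1 s.-1.
(* Twisting at [i] brings the translated set between consecutive balls without changing any
   neighbourhood size, so the uniqueness of colex segments applies. *)
have sD := sandwiched_twist s0 upA iA.
set D := twist_set i s A1 in sD.
have eD : twist_set i s D = A1 := twist_setK i s A1.
have [|||sigma e] := @sandwiched_colex_iso n s k D s0 sn kle' sD.
- by rewrite card_twist_set cap card_imset //; apply: cube_aut_inj.
- by move=> t; rewrite -(card_nbhd_twist t i sn sD) eD; have [<- _] := card1 t.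
- by move=> t; rewrite -(card_nbhd_twist_setC t i s0 sn sD) eD; have [_ <-] := card1 t.
(* Undoing the twist after permuting moves its direction to [sigma i], and the earlier translation
   by [p] becomes one by its image. *)
exists (sigma i), sigma, (sigma @: p).
rewrite A_iE -/s -e -twist_set_perm eD -imset_comp; apply: eq_imset => x /=.
by rewrite cube_aut_comp.
Qed.
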